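(* Let $d\ge 2$, $M\ge N\ge 1$ be integers. For $c\in[0,1]$ let $\rho(c)$ be the average state at overlap $c$, and let $p(J|c)=\mathrm{Tr}[\Pi_J\rho(c)]$. The projective measurement $\{\Pi_J\}_J$ is optimal both for local and for global estimation of $c$, in the following sense: for every POVM $\{E_k\}_k$ on $(\mathbb{C}^d)^{\otimes(N+M)}$ and every real-valued estimator $k\mapsto c(k)$ there is a real-valued estimator $J\mapsto\hat c(J)$ such that for all $c\in[0,1]$ $$\sum_J p(J|c)\,(\hat c(J)-c)^2\;\le\;\sum_k \mathrm{Tr}[E_k\rho(c)]\,(c(k)-c)^2,$$ and consequently, with $p(c)=(d-1)(1-c)^{d-2}$, $$\int_0^1 dc\,p(c)\sum_J p(J|c)\,(\hat c(J)-c)^2\;\le\;\int_0^1 dc\,p(c)\sum_k \mathrm{Tr}[E_k\rho(c)]\,(c(k)-c)^2 .$$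
   Context: For unit vectors $|\psi\rangle,|\phi\rangle\in\mathbb{C}^d$ with $|\langle\psi|\phi\rangle|^2=c$, $$\rho(c)=\int_{SU(d)}dU\;U^{\otimes(N+M)}\left(|\psi\rangle\langle\psi|^{\otimes N}\otimes|\phi\rangle\langle\phi|^{\otimes M}\right)U^{\dagger\otimes(N+M)}$$ ($dU$ normalized Haar measure; the state depends only on $c$). By Schur–Weyl duality $(\mathbb{C}^d)^{\otimes(N+M)}\cong\bigoplus_Y\mathcal{U}^{(Y)}(SU(d))\otimes\mathcal{U}^{(Y)}(S_{N+M})$; $\Pi_J$ is the orthogonal projector onto the block of the Young diagram with rows $(J_{\max}+J,\,J_{\max}-J)$, where $J_{\max}=\frac{M+N}{2}$ and $J$ runs in unit steps from $J_{\min}=\frac{M-N}{2}$ to $J_{\max}$ (these blocks contain the support of every $\rho(c)$). A POVM is a finite family of positive semidefinite operators summing to the identity. $p(c)$ is the density of $|\langle\psi|\phi\rangle|^2$ for independent Haar-random pure states. *)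

(* Defs.v *)
From HB Require Import structures.
From mathcomp Require Import all_boot all_order all_algebra all_fingroup.
From mathcomp Require Import sesquilinear spectral complex.
From mathcomp Require Import all_classical all_reals all_analysis.

Set Implicit Arguments.
Unset Strict Implicit.
Unset Printing Implicit Defensive.

Import Order.TTheory GRing.Theory Num.Theory.

Local Open Scope classical_set_scope.
Local Open Scope ring_scope.
Local Open Scope complex_scope.
Local Open Scope sesquilinear_scope.

Section SpecialUnitary.
Variables (R : realType) (d : nat).

Definition special_unitary (U : 'M[R[i]]_d) : bool :=
  (U \is unitarymx) && (\det U == 1).

Definition SU : Type := {U : 'M[R[i]]_d | special_unitary U}.

HB.instance Definition _ := Choice.on SU.

Fact SU_one_subproof : special_unitary 1%:M.
Proof.
by apply/andP; rewrite det1; split=> //; apply/unitarymxP; rewrite mul1mx trmx1 map_mx1.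
Qed.

HB.instance Definition _ := isPointed.Build SU (exist special_unitary _ SU_one_subproof).

Fact SU_mul_subproof (V U : SU) : special_unitary (sval V *m sval U).
Proof.
case: V U => [V /andP[uV /eqP dV]] [U /andP[uU /eqP dU]] /=.
by rewrite /special_unitary det_mulmx dV dU mulr1 eqxx andbT mul_unitarymx.
Qed.

Definition SU_mul (V U : SU) : SU := exist special_unitary _ (SU_mul_subproof V U).

(* The real and imaginary parts of the entries embed SU(d) in R^(2 d^2); the
   sigma-algebra they generate is the Borel one. *)
Definition SU_coordinate_sets : set_system SU :=
  [set A | exists i j, exists2 B : set R, measurable B &
     A = [set U : SU | B (complex.Re (sval U i j))] \/
     A = [set U : SU | B (complex.Im (sval U i j))]].

Definition SU_borel := g_sigma_algebraType SU_coordinate_sets.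

(* On a compact group the left-invariant probability measure is unique (and
   bi-invariant). *)
Definition is_haar (mu : probability SU_borel R) : Prop :=
  forall (V : SU) (A : set SU_borel),
    measurable A -> mu (SU_mul V @^-1` A) = mu A.

End SpecialUnitary.

Section TensorPower.
Variables (R : realType) (d n : nat).

(* (C^d)^{(x) n} has the orthonormal basis e_f = e_(f 0) (x) ... (x) e_(f n-1)
   indexed by the functions f : {ffun 'I_n -> 'I_d}. *)
Definition tensor_dim : nat := #|{ffun 'I_n -> 'I_d}|.

Definition multi_index (i : 'I_tensor_dim) : {ffun 'I_n -> 'I_d} :=
  @enum_val {ffun 'I_n -> 'I_d} predT i.

(* A_0 (x) ... (x) A_(n-1) *)
Definition tensor_prod (A : 'I_n -> 'M[R[i]]_d) : 'M[R[i]]_tensor_dim :=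
  \matrix_(f, g) \prod_(t < n) A t (multi_index f t) (multi_index g t).

(* The operator moving tensor factor t to position s t:
   perm_op s e_f = e_(f \o s^-1). *)
Definition perm_op (s : 'S_n) : 'M[R[i]]_tensor_dim :=
  \matrix_(g, f) ([forall t, multi_index g (s t) == multi_index f t])%:R.

(* The numbers 0, ..., n-1 fill the Young diagram with row lengths la, where
   sumn la = n, row by row: the cell of t has row [reshape_index la t] and column
   [reshape_offset la t]. *)
Definition row_stabilizer (la : seq nat) : pred 'S_n :=
  [pred s : 'S_n | [forall t, reshape_index la (s t) == reshape_index la t]].

Definition col_stabilizer (la : seq nat) : pred 'S_n :=
  [pred s : 'S_n | [forall t, reshape_offset la (s t) == reshape_offset la t]].

Definition young_symmetrizer (la : seq nat) : 'M[R[i]]_tensor_dim :=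
  (\sum_(s | row_stabilizer la s) perm_op s) *m
  (\sum_(s | col_stabilizer la s) (-1) ^+ odd_perm s *: perm_op s).

(* The block of the diagram la in the Schur-Weyl decomposition: the S_n-span of
   the Weyl module, i.e. of the range of the Young symmetrizer.  Subspaces are
   row spaces here, so the vectors of the block appear transposed. *)
Definition young_block (la : seq nat) : 'M[R[i]]_tensor_dim :=
  (\sum_(s : 'S_n) (perm_op s *m young_symmetrizer la)^T)%MS.

(* [proj_ortho] acts on row vectors, whence the outer transpose. *)
Definition young_proj (la : seq nat) : 'M[R[i]]_tensor_dim :=
  (proj_ortho (young_block la))^T.

End TensorPower.

Section Measurement.
Variables (R : realType) (m : nat).

Definition psdmx (E : 'M[R[i]]_m) : Prop :=
  E = E ^t* /\ forall v : 'cV[R[i]]_m, 0 <= (v ^t* *m E *m v) 0 0.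

Definition is_povm (K : finType) (E : K -> 'M[R[i]]_m) : Prop :=
  (forall k, psdmx (E k)) /\ \sum_k E k = 1%:M.

(* The trace is real for self-adjoint E and rho. *)
Definition outcome_prob (E rho : 'M[R[i]]_m) : R := complex.Re (\tr (E *m rho)).

Definition mean_sq_error (K : finType) (E : K -> 'M[R[i]]_m) (est : K -> R)
    (rho : 'M[R[i]]_m) (c : R) : R :=
  \sum_k outcome_prob (E k) rho * (est k - c) ^+ 2.

End Measurement.

Section AverageState.
Variables (R : realType) (d N M : nat).

Definition ketbra (psi : 'cV[R[i]]_d) : 'M[R[i]]_d := psi *m psi ^t*.

Definition braket (psi phi : 'cV[R[i]]_d) : R[i] := (psi ^t* *m phi) 0 0.

(* |psi><psi|^{(x) N} (x) |phi><phi|^{(x) M} *)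
Definition product_state (psi phi : 'cV[R[i]]_d) : 'M[R[i]]_(tensor_dim d (N + M)) :=
  tensor_prod (fun t : 'I_(N + M) =>
    match fintype.split t with inl _ => ketbra psi | inr _ => ketbra phi end).

Definition rotated_state (psi phi : 'cV[R[i]]_d) (U : SU_borel R d) :
    'M[R[i]]_(tensor_dim d (N + M)) :=
  let Un := tensor_prod (fun _ : 'I_(N + M) => sval U) in
  Un *m product_state psi phi *m Un ^t*.

Definition average_state (mu : probability (SU_borel R d) R)
    (psi phi : 'cV[R[i]]_d) : 'M[R[i]]_(tensor_dim d (N + M)) :=
  \matrix_(f, g)
    ((\int[mu]_(U in setT) complex.Re (rotated_state psi phi U f g)) +i*
     (\int[mu]_(U in setT) complex.Im (rotated_state psi phi U f g))).

Definition is_average_state_at (mu : probability (SU_borel R d) R) (c : R)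
    (sigma : 'M[R[i]]_(tensor_dim d (N + M))) : Prop :=
  exists psi phi : 'cV[R[i]]_d,
    [/\ braket psi psi = 1, braket phi phi = 1,
        `|braket psi phi| ^+ 2 = c%:C
      & sigma = average_state mu psi phi].

(* J = (M - N) / 2 + j, so that the rows J_max + J and J_max - J, with
   J_max = (M + N) / 2, have lengths M + j and N - j. *)
Definition PiJ (j : 'I_N.+1) : 'M[R[i]]_(tensor_dim d (N + M)) :=
  young_proj R d (N + M) [:: (M + j)%N; (N - j)%N].

Definition overlap_density (c : R) : R := d.-1%:R * (1 - c) ^+ (d - 2).

End AverageState.

(* Main.v *)
Require Import Defs.
From mathcomp Require Import all_boot all_order all_algebra all_fingroup.
From mathcomp Require Import sesquilinear spectral complex.
From mathcomp Require Import all_classical all_reals all_analysis.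
From mathcomp Require Import measurable_realfun.
From mathcomp Require Import ring zify.

(** The average state commutes with U^{(x)(N+M)} for every unitary U and is fixed
    by S_N x S_M on both sides.  An operator with these invariances is determined
    by its N+1 diagonal entries at the words 1^k 0^(N-k) 0^M: commutation with the
    unitaries 1 + w p, p a projector, gives commutation with the derivations by the
    elementary matrices, and the resulting relations express every other entry
    through these.  On the other hand, if P is the projector onto
    Sym^N (x) Sym^M, the operators Q_j = Pi_j P, j = 0, ..., N, are nonzero,
    pairwise orthogonal and invariant, so they form a basis, and
    rho(c) = sum_j p(j|c) Q_j / tr Q_j.  Hence every POVM only post-processes the
    outcome J, through q(k|j) = tr (E_k Q_j) / tr Q_j, and the mean
    chat(j) = sum_k q(k|j) c(k) is at least as good by Jensen's inequality. *)

Import Order.TTheory GRing.Theory Num.Theory.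

Set Implicit Arguments.
Unset Strict Implicit.
Unset Printing Implicit Defensive.

Local Open Scope ring_scope.
Local Open Scope sesquilinear_scope.

(** * Tensor powers and permutation operators *)

Section Tensors.
Variables (R : realType) (d n : nat).
Local Notation C := (complex R).
Local Notation word := {ffun 'I_n -> 'I_d}.
Local Notation op := 'M[C]_(tensor_dim d n).

(** Neither irreducibility of the components nor Schur-Weyl duality is invoked: two elementary
    counts meet instead. Evaluation at the N+1 diagonal entries bounds the dimension of the space of
    invariant operators from above, the operators Q_j bound it from below. The delicate half is that
    Q_j does not vanish: the tableau is filled row by row, with a first row of length M + j, while
    the state is symmetric under the cut at N. This mismatch is why a highest weight vector is
    combined with the reversal of positions. The Haar average runs over SU(d) only, whereas 1 + w p
    need not have determinant 1; a phase repairs this, since scalars cancel from commutation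
    relations. Finally, q(k|j) does not involve c, so one estimator serves all c at once, and the
    global claim follows pointwise. *)

Definition idx (f : word) : 'I_(tensor_dim d n) := enum_rank f.

Definition fperm (f : word) (s : 'S_n) : word := [ffun t => f (s t)].

Lemma multi_indexK (i : 'I_(tensor_dim d n)) : idx (multi_index i) = i.
Proof. by rewrite /idx /multi_index enum_valK. Qed.

Lemma idxK (f : word) : multi_index (idx f) = f.
Proof. by rewrite /idx /multi_index enum_rankK. Qed.

Lemma sum_idx (V : nmodType) (F : 'I_(tensor_dim d n) -> V) :
  \sum_i F i = \sum_f F (idx f).
Proof.
rewrite (reindex idx) //=; exists (@multi_index d n) => i _.
  exact: idxK.
exact: multi_indexK.
Qed.

Lemma mx_idxP m (X Y : 'M[C]_(tensor_dim d n, m)) :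
  (forall f j, X (idx f) j = Y (idx f) j) -> X = Y.
Proof. by move=> XY; apply/matrixP => i j; rewrite -(multi_indexK i) XY. Qed.

Lemma op_idxP (X Y : op) :
  (forall f g, X (idx f) (idx g) = Y (idx f) (idx g)) -> X = Y.
Proof.
by move=> XY; apply/mx_idxP => f j; rewrite -(multi_indexK j) XY.
Qed.

Lemma adjE m1 m2 (A : 'M[C]_(m1, m2)) i j : (A ^t*) i j = (A j i)^*.
Proof. by rewrite !mxE. Qed.

Lemma adjM m1 m2 m3 (A : 'M[C]_(m1, m2)) (B : 'M[C]_(m2, m3)) :
  (A *m B) ^t* = B ^t* *m A ^t*.
Proof. by rewrite trmx_mul map_mxM. Qed.

Lemma adjK m1 m2 (A : 'M[C]_(m1, m2)) : A ^t* ^t* = A.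
Proof. by apply/matrixP => i j; rewrite !mxE conjCK. Qed.

Lemma tensor_prodE (A : 'I_n -> 'M[C]_d) f g :
  tensor_prod A (idx f) (idx g) = \prod_t A t (f t) (g t).
Proof. by rewrite mxE !idxK. Qed.

Lemma tensor_prodM (A B : 'I_n -> 'M[C]_d) :
  tensor_prod A *m tensor_prod B = tensor_prod (fun t => A t *m B t).
Proof.
apply/op_idxP => f g; rewrite mxE sum_idx tensor_prodE.
under [RHS]eq_bigr do rewrite mxE.
rewrite bigA_distr_bigA /=; apply: eq_bigr => h _.
by rewrite !tensor_prodE -big_split.
Qed.

Lemma tensor_prod_adj (A : 'I_n -> 'M[C]_d) :
  (tensor_prod A) ^t* = tensor_prod (fun t => (A t) ^t*).
Proof.
apply/op_idxP => f g; rewrite adjE !tensor_prodE rmorph_prod.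
by apply: eq_bigr => t _; rewrite adjE.
Qed.

Lemma eq_tensor_prod (A B : 'I_n -> 'M[C]_d) :
  A =1 B -> tensor_prod A = tensor_prod B.
Proof.
by move=> AB; apply/op_idxP => f g; rewrite !tensor_prodE; under eq_bigr do rewrite AB.
Qed.

Lemma ffun_neq (f g : word) : f != g -> exists t, f t != g t.
Proof.
move=> fg; apply/existsP; apply: contraNT fg; rewrite negb_exists => /forallP fg.
by apply/eqP/ffunP => t; move/(_ t): fg; rewrite negbK => /eqP.
Qed.

Lemma tensor_prod1 : tensor_prod (fun=> 1%:M) = 1%:M :> op.
Proof.
apply/op_idxP => f g; rewrite tensor_prodE mxE (inj_eq enum_rank_inj).
have [->|/ffun_neq[t ft]] := eqVneq f g.
  by rewrite big1 // => t _; rewrite mxE eqxx.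
by rewrite (bigD1 t) //= mxE (negbTE ft) mul0r.
Qed.

Lemma perm_opE s f g : perm_op R d s (idx f) (idx g) = (fperm f s == g)%:R.
Proof.
rewrite mxE !idxK; congr (nat_of_bool _)%:R; apply/forallP/eqP => [fg|<- t].
  by apply/ffunP => t; rewrite ffunE; apply/eqP.
by rewrite ffunE.
Qed.

Lemma fperm1 f : fperm f 1%g = f.
Proof. by apply/ffunP => t; rewrite ffunE perm1. Qed.

Lemma fpermM f (s t : 'S_n) : fperm (fperm f s) t = fperm f (t * s)%g.
Proof. by apply/ffunP => x; rewrite !ffunE permM. Qed.

Lemma fpermK f (s : 'S_n) : fperm (fperm f s) s^-1%g = f.
Proof. by rewrite fpermM mulVg fperm1. Qed.

Lemma fpermVK f (s : 'S_n) : fperm (fperm f s^-1%g) s = f.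
Proof. by rewrite fpermM mulgV fperm1. Qed.

Lemma perm_mulE m s (X : 'M[C]_(tensor_dim d n, m)) f j :
  (perm_op R d s *m X) (idx f) j = X (idx (fperm f s)) j.
Proof.
rewrite mxE sum_idx (bigD1 (fperm f s)) //= perm_opE eqxx mul1r big1 ?addr0 //.
by move=> g gf; rewrite perm_opE eq_sym (negbTE gf) mul0r.
Qed.

Lemma mul_permE m s (X : 'M[C]_(m, tensor_dim d n)) i f :
  (X *m perm_op R d s) i (idx f) = X i (idx (fperm f s^-1%g)).
Proof.
rewrite mxE sum_idx (bigD1 (fperm f s^-1%g)) //= perm_opE fpermVK eqxx mulr1.
rewrite big1 ?addr0 // => g gf; rewrite perm_opE.
case: (eqVneq (fperm g s) f) => [gE|_]; last by rewrite mulr0.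
by rewrite -gE fpermK eqxx in gf.
Qed.

(** Products in ['S_n] apply the left factor first, so [t * s] is the map s o t and [perm_op]
    respects composition of maps. *)
Lemma perm_opM (s t : 'S_n) : perm_op R d s *m perm_op R d t = perm_op R d (t * s)%g.
Proof. by apply/op_idxP => f g; rewrite perm_mulE !perm_opE fpermM. Qed.

Lemma perm_op1 : perm_op R d 1%g = 1%:M :> op.
Proof.
by apply/op_idxP => f g; rewrite perm_opE mxE (inj_eq enum_rank_inj) fperm1.
Qed.

Lemma perm_op_tr (s : 'S_n) : (perm_op R d s)^T = perm_op R d s^-1%g.
Proof.
apply/op_idxP => f g; rewrite mxE !perm_opE; congr (nat_of_bool _)%:R.
by apply/eqP/eqP => <-; rewrite ?fpermVK ?fpermK.
Qed.

Lemma perm_op_adj (s : 'S_n) : (perm_op R d s) ^t* = perm_op R d s^-1%g.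
Proof.
rewrite perm_op_tr; apply/op_idxP => f g.
by rewrite mxE perm_opE conjC_nat.
Qed.

Lemma perm_op_tensor s (A : 'M[C]_d) :
  perm_op R d s *m tensor_prod (fun _ : 'I_n => A) = tensor_prod (fun _ : 'I_n => A) *m perm_op R d s.
Proof.
apply/op_idxP => f g; rewrite perm_mulE mul_permE !tensor_prodE.
rewrite [RHS](reindex_inj (@perm_inj _ s)) /=; apply: eq_bigr => t _.
by rewrite !ffunE permK.
Qed.

End Tensors.

(** * From unitary invariance to Lie algebra relations *)

Section Commutant.
Variables (R : realType) (d n : nat).
Local Notation C := (complex R).
Local Notation word := {ffun 'I_n -> 'I_d}.
Local Notation op := 'M[C]_(tensor_dim d n).

Definition set_letter (f : word) (t : 'I_n) (i : 'I_d) : word :=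
  [ffun s => if s == t then i else f s].

Lemma deriv_prod (I : eqType) (r : seq I) (P : I -> {poly C}) : uniq r ->
  (\prod_(i <- r) P i)^`() =
  \sum_(i <- r) (P i)^`() * \prod_(j <- r | j != i) P j.
Proof.
elim: r => [|x r IHr] /=; first by rewrite !big_nil derivC.
case/andP=> xr /IHr {}IHr; rewrite !big_cons derivM IHr eqxx /= mulr_sumr.
congr (_ + _).
  congr (_ * _); rewrite [RHS]big_seq_cond [LHS]big_seq.
  apply: eq_bigl => j; case jr: (j \in r) => //=.
  by apply/esym; apply: contraNneq xr => <-.
apply: eq_big_seq => i ir.
rewrite big_cons ifT; last by apply: contraNneq xr => ->.
by rewrite mulrCA.
Qed.

(** The coefficient of X is the derivative at 0, and Leibniz leaves one differentiated factor at a
    time. *)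
Lemma coef1_prod_affine (I : finType) (a b : I -> C) :
  (\prod_i ((a i)%:P + b i *: 'X))`_1 = \sum_i b i * \prod_(j | j != i) a j.
Proof.
have -> (p : {poly C}) : p`_1 = p^`().[0].
  by rewrite horner_coef0 coef_deriv mulr1n.
rewrite deriv_prod ?index_enum_uniq // horner_sum; apply: eq_bigr => i _.
rewrite derivD derivC add0r derivZ derivX hornerM hornerZ hornerC mulr1.
congr (_ * _); rewrite horner_prod; apply: eq_bigr => j _.
by rewrite hornerD hornerC hornerZ hornerX mulr0 addr0.
Qed.

Lemma horner_prod_affine (I : finType) (a b : I -> C) (w : C) :
  (\prod_i ((a i)%:P + b i *: 'X)).[w] = \prod_i (a i + w * b i).
Proof.
rewrite horner_prod; apply: eq_bigr => i _.
by rewrite hornerD hornerC hornerZ hornerX mulrC.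
Qed.

(** The Kronecker deltas force h to agree with f off position t, so only the words
    [set_letter f t j] survive. *)
Lemma sum_one_letter (B : 'M[C]_d) (t : 'I_n) (f : word) (F : word -> C) :
  \sum_(h : word) B (f t) (h t) * \prod_(s | s != t) (f s == h s)%:R * F h =
  \sum_j B (f t) j * F (set_letter f t j).
Proof.
rewrite (partition_big (fun h : word => h t) predT) //=.
apply: eq_bigr => j _; rewrite (bigD1 (set_letter f t j)) /=; last by rewrite ffunE eqxx.
rewrite [X in _ + X]big1 ?addr0 => [|h /andP[/eqP htj hj]].
  rewrite ffunE eqxx big1 ?mulr1 // => s st.
  by rewrite ffunE (negbTE st) eqxx.
have [s] := ffun_neq hj; rewrite ffunE; case: (eqVneq s t) => [->|st fs].
  by rewrite htj eqxx.
by rewrite (bigD1 s) //= (eq_sym (f s)) (negbTE fs) mul0r mulr0 mul0r.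
Qed.

Lemma sum_one_letter_r (B : 'M[C]_d) (t : 'I_n) (f : word) (F : word -> C) :
  \sum_(h : word) B (h t) (f t) * \prod_(s | s != t) (h s == f s)%:R * F h =
  \sum_j B j (f t) * F (set_letter f t j).
Proof.
have := sum_one_letter B^T t f F.
under eq_bigr do rewrite mxE; under [X in _ = X]eq_bigr do rewrite mxE.
move=> <-; apply: eq_bigr => h _; congr (_ * _ * _).
by apply: eq_bigr => s _; rewrite eq_sym.
Qed.

(* The entrywise form of: X commutes with the derivation
   sum_t 1 (x) ... (x) B (x) ... (x) 1 (B in position t). *)
Definition lie_comm (X : op) (B : 'M[C]_d) := forall f g : word,
  \sum_t \sum_j B (f t) j * X (idx (set_letter f t j)) (idx g) =
  \sum_t \sum_j B j (g t) * X (idx f) (idx (set_letter g t j)).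

Lemma lie_commD X B B' : lie_comm X B -> lie_comm X B' -> lie_comm X (B + B').
Proof.
move=> XB XB' f g; transitivity
 ((\sum_t \sum_j B (f t) j * X (idx (set_letter f t j)) (idx g)) +
  (\sum_t \sum_j B' (f t) j * X (idx (set_letter f t j)) (idx g))).
  rewrite -big_split; apply: eq_bigr => t _; rewrite -big_split.
  by apply: eq_bigr => j _; rewrite mxE mulrDl.
rewrite XB XB' -big_split; apply: eq_bigr => t _; rewrite -big_split.
by apply: eq_bigr => j _; rewrite mxE mulrDl.
Qed.

Lemma lie_commZ X B a : lie_comm X B -> lie_comm X (a *: B).
Proof.
move=> XB f g; have /(congr1 (fun z => a * z)) := XB f g.
rewrite !mulr_sumr => XB'; transitivity
 (\sum_t a * (\sum_j B (f t) j * X (idx (set_letter f t j)) (idx g))).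
  apply: eq_bigr => t _; rewrite mulr_sumr.
  by apply: eq_bigr => j _; rewrite mxE mulrA.
rewrite XB'; apply: eq_bigr => t _; rewrite mulr_sumr.
by apply: eq_bigr => j _; rewrite mxE mulrA.
Qed.

(** The Cayley transform of the integers supplies infinitely many values w with |1 + w| = 1, enough
    to annihilate a polynomial of any degree. *)
Definition cayley (m : nat) : C := (1 + 'i * m%:R) / (1 - 'i * m%:R) - 1.

Lemma cayley_den m : 1 - 'i * m%:R != 0 :> C.
Proof.
apply/eqP => /eqP; rewrite subr_eq0 => /eqP im1.
have im2 : ('i * m%:R) ^+ 2 = 1 :> C by rewrite -im1 expr1n.
have /eqP : 1 + m%:R ^+ 2 = 0 :> C.
  by rewrite -{1}im2 exprMn sqrCi mulN1r addNr.
by rewrite -natrX nat1r pnatr_eq0.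
Qed.

Lemma cayley_num m : 1 + 'i * m%:R != 0 :> C.
Proof.
rewrite -conjC_eq0 rmorphD rmorphM /= conjCi conjC1 conjC_nat mulNr.
exact: cayley_den.
Qed.

Lemma cayley_inj : injective cayley.
Proof.
move=> m1 m2 /addIr /eqP; rewrite eqr_div ?cayley_den // => /eqP E.
apply/eqP; rewrite -(eqr_nat C); apply/eqP.
have i2 : 2 * 'i != 0 :> C by rewrite mulf_neq0 ?neq0Ci ?pnatr_eq0.
apply: (mulfI i2); apply/eqP; rewrite -subr_eq0.
have -> : 2 * 'i * m1%:R - 2 * 'i * m2%:R =
    (1 + 'i * m1%:R) * (1 - 'i * m2%:R) - (1 + 'i * m2%:R) * (1 - 'i * m1%:R) :> C.
  by ring.
by rewrite E subrr.
Qed.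

Lemma cayley_circle m : cayley m + (cayley m)^* + cayley m * (cayley m)^* = 0.
Proof.
have -> : (cayley m)^* = (1 - 'i * m%:R) / (1 + 'i * m%:R) - 1.
  rewrite /cayley rmorphB fmorph_div rmorphD rmorphB rmorphM /=.
  by rewrite conjCi conjC1 conjC_nat mulNr opprK.
rewrite /cayley; field.
by rewrite cayley_den cayley_num.
Qed.

Definition tensor_comm (X : op) := forall U : 'M[C]_d, U \is unitarymx ->
  tensor_prod (fun _ : 'I_n => U) *m X = X *m tensor_prod (fun _ : 'I_n => U).

(* For a projector p, the operators 1 + w p with |1 + w| = 1 are unitary, and their
   tensor powers are polynomial in w with linear coefficient the derivation by p. *)
Lemma lie_comm_proj X (p : 'M[C]_d) : tensor_comm X -> p ^t* = p -> p *m p = p ->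
  lie_comm X p.
Proof.
move=> cX p_adj p_idem f g.
pose V f g : {poly C} := \prod_(t : 'I_n) ((f t == g t)%:R%:P + p (f t) (g t) *: 'X).
(* Entry (f, g) of the commutator of the tensor power of 1 + w p with X, as a polynomial in w. *)
pose Q : {poly C} := \sum_(h : word) X (idx h) (idx g) *: V f h
           - \sum_(h : word) X (idx f) (idx h) *: V h g.
have Q0 m : root Q (cayley m).
  set w := cayley m; pose U := 1%:M + w *: p.
  have uU : U \is unitarymx.
    apply/unitarymxP; rewrite linearD /= map_mxD /= trmx1 map_mx1 linearZ /= map_mxZ p_adj.
    rewrite mulmxDl mulmxDr mul1mx mulmxDr mul1mx mulmx1.
    rewrite -scalemxAl -scalemxAr p_idem.
    transitivity (1%:M + (w + w^* + w * w^*) *: p).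
      by apply/matrixP => i j; rewrite !mxE; ring.
    by rewrite cayley_circle scale0r addr0.
  have := congr1 (fun Y : op => Y (idx f) (idx g)) (cX U uU).
  rewrite !mxE !sum_idx /root /Q hornerD hornerN !horner_sum => E.
  rewrite subr_eq0; apply/eqP; transitivity
   (\sum_(h : word) tensor_prod (fun _ : 'I_n => U) (idx f) (idx h) * X (idx h) (idx g)).
    apply: eq_bigr => h _; rewrite hornerZ horner_prod_affine tensor_prodE mulrC.
    by congr (_ * _); apply: eq_bigr => t _; rewrite !mxE.
  rewrite E.
  apply: eq_bigr => h _; rewrite hornerZ horner_prod_affine tensor_prodE.
  by congr (_ * _); apply: eq_bigr => t _; rewrite !mxE.
have {Q0} Q0 : Q = 0.
  apply: (@roots_geq_poly_eq0 _ Q (map cayley (iota 0 (size Q)))).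
  - by apply/allP => w /mapP[m _ ->].
  - by rewrite map_inj_uniq ?iota_uniq //; exact: cayley_inj.
  - by rewrite size_map size_iota.
have := congr1 (fun q : {poly C} => q`_1) Q0.
rewrite coef0 coefB !coef_sum => /eqP; rewrite subr_eq0 => /eqP E.
transitivity (\sum_(h : word) (X (idx h) (idx g) *: V f h)`_1).
  under eq_bigr do rewrite -(sum_one_letter p _ f (fun h => X (idx h) (idx g))).
  rewrite exchange_big; apply: eq_bigr => h _ /=.
  by rewrite coefZ coef1_prod_affine mulr_sumr; apply: eq_bigr => t _; rewrite mulrC.
rewrite E.
under [RHS]eq_bigr do rewrite -(sum_one_letter_r p _ g (fun h => X (idx f) (idx h))).
rewrite [RHS]exchange_big; apply: eq_bigr => h _ /=.
by rewrite coefZ coef1_prod_affine mulr_sumr; apply: eq_bigr => t _; rewrite mulrC.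
Qed.

(** The operator v v^* is |v|^2 times the orthogonal projector onto the line of v. *)
Lemma lie_comm_rank1 X (v : 'cV[C]_d) : tensor_comm X -> v != 0 ->
  lie_comm X (v *m v ^t*).
Proof.
move=> cX v0; pose a := (v ^t* *m v) 0 0.
have aE : v ^t* *m v = a%:M by apply/matrixP => i j; rewrite !ord1 [RHS]mxE eqxx mulr1n.
have a_ge0 : 0 < a.
  rewrite /a mxE; have /existsP[i vi] : [exists i, v i 0 != 0].
    apply: contraNT v0; rewrite negb_exists => /forallP v0; apply/eqP/colP => i.
    by rewrite mxE; apply/eqP; rewrite -[_ == _]negbK v0.
  rewrite (bigD1 i) //= ltr_wpDr ?sumr_ge0 // ?adjE 1?mulrC ?mul_conjC_gt0 //.
  by move=> j _; rewrite adjE mulrC mul_conjC_ge0.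
have -> : v *m v ^t* = a *: (a^-1 *: (v *m v ^t*)).
  by rewrite scalerA mulfV ?scale1r // gt_eqF.
apply/lie_commZ/lie_comm_proj => //.
  rewrite linearZ /= map_mxZ adjM adjK; congr (_ *: _).
  by apply/CrealP; rewrite rpredV gtr0_real.
rewrite -scalemxAl -scalemxAr scalerA mulmxA -(mulmxA v) aE mul_mx_scalar.
by rewrite -scalemxAl scalerA mulfVK ?gt_eqF.
Qed.

(** Polarization: for v = e_i + w e_j, removing the diagonal terms of v v^* leaves w^* E_ij + w
    E_ji. *)
Lemma lie_comm_delta X i j : tensor_comm X -> lie_comm X (delta_mx i j).
Proof.
move=> cX; pose e k : 'cV[C]_d := delta_mx k 0.
have eE k l : e k *m (e l) ^t* = delta_mx k l.
  by rewrite trmx_delta map_delta_mx mul_delta_mx.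
have e0 k : e k != 0.
  by apply/eqP => /matrixP/(_ k 0); rewrite !mxE !eqxx => /eqP; rewrite oner_eq0.
have diag k : lie_comm X (delta_mx k k) by rewrite -eE; exact: lie_comm_rank1.
have [<-//|ij] := eqVneq i j.
have mix w : lie_comm X (w^* *: delta_mx i j + w *: delta_mx j i).
  have v0 : e i + w *: e j != 0.
    apply/eqP => /matrixP/(_ i 0); rewrite !mxE !eqxx (negbTE ij) mulr0 addr0.
    by move/eqP; rewrite oner_eq0.
  have := lie_comm_rank1 cX v0.
  rewrite linearD /= map_mxD linearZ /= map_mxZ mulmxDl !mulmxDr.
  rewrite -!scalemxAl -!scalemxAr !eE => cv.
  have := lie_commD (lie_commD cv (lie_commZ (-1) (diag i)))
                    (lie_commZ (- (w * w^*)) (diag j)).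
  congr lie_comm; rewrite scalerA; apply/matrixP => k l; rewrite !mxE; ring.
(* w = 1 gives E_ij + E_ji, and 'i times the case w = 'i gives E_ij - E_ji. *)
have := lie_commZ (1 / 2) (lie_commD (mix 1) (lie_commZ 'i (mix 'i))).
congr lie_comm; apply/matrixP => k l; rewrite !mxE conjC1 conjCi.
by have i2 := sqrCi C; field: i2.
Qed.

Lemma lie_comm_entry X (i j : 'I_d) (f g : word) : tensor_comm X ->
  \sum_t (f t == i)%:R * X (idx (set_letter f t j)) (idx g) =
  \sum_t (g t == j)%:R * X (idx f) (idx (set_letter g t i)).
Proof.
move=> /(lie_comm_delta i j)/(_ f g) E.
transitivity (\sum_t \sum_k (delta_mx i j : 'M[C]_d) (f t) k * X (idx (set_letter f t k)) (idx g)).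
  apply: eq_bigr => t _; rewrite (bigD1 j) //= mxE eqxx andbT big1 ?addr0 // => k kj.
  by rewrite mxE (negbTE kj) andbF mul0r.
rewrite E; apply: eq_bigr => t _; rewrite (bigD1 i) //= mxE eqxx /= big1 ?addr0 // => k ki.
by rewrite mxE (negbTE ki) mul0r.
Qed.

End Commutant.

(** * Determination of an invariant operator by N+1 entries *)

Section Determination.
Variables (R : realType) (d N M : nat) (o0 o1 : 'I_d).
Hypothesis o01 : o0 != o1.
Local Notation C := (complex R).
Local Notation n := (N + M)%N.
Local Notation word := {ffun 'I_n -> 'I_d}.
Local Notation op := 'M[C]_(tensor_dim d n).

Definition young_subgroup (s : 'S_n) : bool :=
  [forall t, (s t < N)%N == (t < N)%N].

Definition step_word (k : nat) : word := [ffun t : 'I_n => if (t < k)%N then o1 else o0].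

(** A letter other than [o0] costs 2 in the second block and at most 1 in the first, so moving it
    from the second block to the first lowers the total. *)
Local Definition weight (t : 'I_n) (i : 'I_d) : nat :=
  if (t < N)%N then ((i != o0) && (i != o1) : nat) else (2 * (i != o0))%N.

Local Definition total (f : word) : nat := (\sum_t weight t (f t))%N.

Local Lemma total_set_letter f t i :
  (total (set_letter f t i) + weight t (f t) = total f + weight t i)%N.
Proof.
rewrite /total (bigD1 t) //= [in RHS](bigD1 t) //= ffunE eqxx.
rewrite (eq_bigr (fun s => weight s (f s))) => [|s st]; last by rewrite ffunE (negbTE st).
by rewrite addnAC [RHS]addnAC [(weight t i + _)%N]addnC.
Qed.

(** Stated for functions of two words so that it is visibly stable under exchanging the arguments;
    each reduction is then proved for g only. *)
Definition invariant_kernel (Y : word -> word -> C) : Prop :=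
  [/\ forall s f g, young_subgroup s -> Y (fperm f s) g = Y f g,
      forall s f g, young_subgroup s -> Y f (fperm g s) = Y f g &
      forall i j (f g : word), \sum_t (f t == i)%:R * Y (set_letter f t j) g =
                      \sum_t (g t == j)%:R * Y f (set_letter g t i)].

Local Lemma invariant_kernel_swap Y :
  invariant_kernel Y -> invariant_kernel (fun f g => Y g f).
Proof.
by case=> Yl Yr YD; split=> [s f g|s f g|i j f g]; [exact: Yr|exact: Yl|rewrite YD].
Qed.

Local Lemma tperm_young_subgroup (t u : 'I_n) :
  (t < N)%N = (u < N)%N -> young_subgroup (tperm t u).
Proof. by move=> tu; apply/forallP => v; case: tpermP => [->|->|]; rewrite ?tu. Qed.

(** Apply the Lie relation for the letters g t0 and k to f and g[t0 := k]. Its left side vanishes by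
    the first hypothesis. On the right, positions in the other block vanish by the second, and each
    position in the block of t0 gives Y f g by permutation invariance; t0 is one of them. So a
    positive integer times Y f g is zero. *)
Local Lemma kernel_step Y (f g : word) t0 k : invariant_kernel Y -> g t0 != k ->
  (forall t, f t = g t0 :> 'I_d -> Y (set_letter f t k) (set_letter g t0 k) = 0) ->
  (forall t, set_letter g t0 k t = k -> (t < N)%N != (t0 < N)%N ->
     Y f (set_letter (set_letter g t0 k) t (g t0)) = 0) ->
  Y f g = 0.
Proof.
case=> Yl Yr YD gk fg0 g0; set h := set_letter g t0 k.
have hg : set_letter h t0 (g t0) = g.
  by apply/ffunP => s; rewrite !ffunE; case: eqVneq => [->|].
have ht0 : h t0 = k by rewrite /h ffunE eqxx.
have same t : h t = k -> (t < N)%N = (t0 < N)%N -> Y f (set_letter h t (g t0)) = Y f g.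
  move=> htk tt0; rewrite -(Yr (tperm t t0) f g) ?tperm_young_subgroup //.
  congr (Y f _); apply/ffunP => s; rewrite [LHS]ffunE [RHS]ffunE.
  have [->|st] := eqVneq s t; first by rewrite tpermL.
  have [st0|st0] := eqVneq s t0; last first.
    by rewrite tpermD 1?eq_sym // /h ffunE (negbTE st0).
  rewrite st0 tpermR ht0; move: htk.
  by rewrite /h ffunE -st0 eq_sym (negbTE st) => ->.
have := YD (g t0) k f h; rewrite big1 => [|t _]; last first.
  by case: eqP => [ft|_]; rewrite ?mul0r // fg0 // mulr0.
rewrite (eq_bigr (fun t => ((h t == k) && ((t < N)%N == (t0 < N)%N))%:R * Y f g)).
  rewrite -mulr_suml => /esym/eqP; rewrite mulf_eq0 => /orP[|/eqP//].
  by rewrite -natr_sum pnatr_eq0 (bigD1 t0) //= ht0 !eqxx.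
move=> t _; case: (h t =P k) => [htk|_]; rewrite ?mul0r //=.
have [tt0|tt0] := eqVneq; first by rewrite same.
by rewrite g0 // mul0r mulr0.
Qed.

Local Definition good (f : word) : bool :=
  [forall t : 'I_n, if (t < N)%N then (f t == o0) || (f t == o1) else f t == o0].

Local Lemma card_lt (k : nat) : (k <= n)%N -> #|[set t : 'I_n | (t < k)%N]| = k.
Proof.
move=> kn; rewrite -sum1_card -[RHS](card_ord k) -[RHS]sum1_card.
by rewrite [RHS] (big_ord_widen n (fun=> 1%N)) //; apply: eq_bigl => t; rewrite inE.
Qed.

Local Lemma good_step_word k : (k <= N)%N -> good (step_word k).
Proof.
move=> kN; apply/forallP => t; rewrite ffunE; case: ltnP => tN.
  by case: ifP; rewrite eqxx ?orbT.
by rewrite ltnNge (leq_trans kN tN).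
Qed.

Local Lemma card_step_word k : (k <= N)%N -> #|[set t | step_word k t == o1]| = k.
Proof.
move=> kN; rewrite -[RHS](@card_lt k) ?(leq_trans kN) ?leq_addr //.
apply: eq_card => t; rewrite !inE ffunE; case: ifP; rewrite ?eqxx //.
by rewrite (negbTE o01).
Qed.

Local Lemma good_perm (f g : word) : good f -> good g ->
  #|[set t | f t == o1]| = #|[set t | g t == o1]| ->
  exists2 s, young_subgroup s & f = fperm g s.
Proof.
move=> gf gg cfg.
(* Letters are tagged with their block, so a permutation matching the two tuples preserves the
   blocks. *)
pose T (f : word) : n.-tuple (bool * 'I_d) := [tuple ((t < N)%N, f t) | t < n].
have cntE h x : count_mem x (T h) = #|[set t : 'I_n | ((t < N)%N, h t) == x]|.
  rewrite -sum1_count -sum1_card big_map big_enum_cond /=.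
  by apply: eq_bigl => t; rewrite inE.
have goodN h (t : 'I_n) : good h -> (t < N)%N -> (h t == o0) = (h t != o1).
  move=> /forallP/(_ t); case: ifP => // _ /orP[]/eqP-> _; rewrite ?eqxx ?o01 //.
  by rewrite eq_sym (negbTE o01).
have goodM h (t : 'I_n) : good h -> (t < N)%N = false -> h t = o0.
  by move=> /forallP/(_ t); case: ifP => // _ /eqP.
have cnt1 h : good h -> [set t : 'I_n | ((t < N)%N, h t) == (true, o1)] = [set t | h t == o1].
  move=> gh; apply/setP => t; rewrite !inE xpair_eqE eqb_id.
  by case tN: (t < N)%N => //=; rewrite goodM // (negbTE o01).
have cnt0 h : good h -> #|[set t : 'I_n | ((t < N)%N, h t) == (true, o0)]| =
    (#|[set t : 'I_n | (t < N)%N]| - #|[set t | h t == o1]|)%N.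
  move=> gh; rewrite -cnt1 // -cardsDS; last first.
    by apply/fintype.subsetP => t; rewrite !inE => /eqP[->].
  apply: eq_card => t; rewrite !inE !xpair_eqE !eqb_id.
  by case tN: (t < N)%N; rewrite ?andbF //= andbT goodN.
have cntM h v : good h -> #|[set t : 'I_n | ((t < N)%N, h t) == (false, v)]| =
    #|[set t : 'I_n | ((t < N)%N, o0) == (false, v)]|.
  move=> gh; apply: eq_card => t; rewrite !inE !xpair_eqE.
  by case tN: (t < N)%N => //=; rewrite goodM.
have cntN h v : good h -> v != o0 -> v != o1 ->
    #|[set t : 'I_n | ((t < N)%N, h t) == (true, v)]| = 0%N.
  move=> gh v0 v1; apply: eq_card0 => t; rewrite !inE xpair_eqE eqb_id.
  case tN: (t < N)%N => //=; apply/negbTE; move/forallP/(_ t): gh; rewrite tN.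
  by case/orP=> /eqP->; rewrite eq_sym.
have /tuple_permP[s sE] : perm_eq (T f) (T g).
  apply/allP => -[b v] _ /=; apply/eqP; rewrite !cntE.
  case: b; last by rewrite !cntM.
  have [->|v0] := eqVneq v o0; first by rewrite !cnt0 // cfg.
  have [->|v1] := eqVneq v o1; first by rewrite !cnt1.
  by rewrite !cntN.
have fgs (t : 'I_n) : ((t < N)%N, f t) = ((s t < N)%N, g (s t)).
  have := congr1 (fun l => nth ((t < N)%N, f t) l t) sE.
  by rewrite -!tnth_nth !tnth_mktuple.
exists s; first by apply/forallP => t; case: (fgs t) => -> _.
by apply/ffunP => t; rewrite ffunE; case: (fgs t).
Qed.

(** The relation for the pair [o1], [o1] counts letters: the difference between the numbers of [o1]
    in f and in g annihilates Y f g. If the numbers agree, both words are rearrangements of the same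
    step word, and the two arguments may be permuted independently. *)
Local Lemma kernel_good0 Y (f g : word) : invariant_kernel Y ->
  (forall k, (k <= N)%N -> Y (step_word k) (step_word k) = 0) ->
  good f -> good g -> Y f g = 0.
Proof.
case=> Yl Yr YD Y0 gf gg.
have set_letter_id (h : word) t : h t = o1 -> set_letter h t o1 = h.
  by move=> ht; apply/ffunP => s; rewrite ffunE; case: eqVneq => // ->.
have := YD o1 o1 f g.
have cnt (h : word) (F : 'I_n -> C) (c : C) : (forall t, h t = o1 -> F t = c) ->
    \sum_t (h t == o1)%:R * F t = #|[set t | h t == o1]|%:R * c.
  move=> Fc; rewrite (eq_bigr (fun t => (h t == o1)%:R * c)) => [|t _]; last first.
    by case: eqP => [/Fc ->|_]; rewrite ?mul0r.
  rewrite -mulr_suml -natr_sum -sum1_card; congr (_%:R * _).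
  by rewrite [RHS]big_mkcond; apply: eq_bigr => t _; rewrite inE; case: eqP.
rewrite (cnt f _ (Y f g)) => [|t ft]; last by rewrite set_letter_id.
rewrite (cnt g _ (Y f g)) => [|t gt]; last by rewrite set_letter_id.
move/eqP; rewrite -subr_eq0 -mulrBl mulf_eq0 subr_eq0 eqr_nat => /orP[/eqP cfg|/eqP//].
set k := #|[set t | f t == o1]| in cfg.
have kN : (k <= N)%N.
  rewrite -[leqRHS](@card_lt N) ?leq_addr //; apply/subset_leq_card/fintype.subsetP => t.
  rewrite !inE => /eqP ft; move/forallP/(_ t): gf; rewrite ft; case: ifP => // _.
  by rewrite eq_sym (negbTE o01).
have [s ys ->] := good_perm gf (good_step_word kN) (esym (card_step_word kN)).
have [u yu ->] := good_perm gg (good_step_word kN) (etrans (esym cfg) (esym (card_step_word kN))).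
by rewrite Yl // Yr // Y0.
Qed.

Local Lemma weight_o0 t : weight t o0 = 0%N.
Proof. by rewrite /weight eqxx if_same. Qed.

Local Lemma kernel_step_right Y (f g : word) (t : 'I_n) : invariant_kernel Y ->
  (forall f' g', (total f' + total g' < total f + total g)%N -> Y f' g' = 0) ->
  (N <= t)%N -> g t != o0 -> Y f g = 0.
Proof.
move=> iY IH Nt gt.
have wg i : i != o0 -> weight t i = 2%N by move=> io; rewrite /weight ltnNge Nt io.
have gE := total_set_letter g t o0; rewrite weight_o0 wg // in gE.
apply: (kernel_step iY gt) => u.
  move=> _; apply: IH; have := total_set_letter f u o0; rewrite weight_o0; lia.
rewrite [(t < N)%N]ltnNge Nt /= => _ uN; apply: IH.
have := total_set_letter (set_letter g t o0) u (g t).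
have : (weight u (g t) <= 1)%N by rewrite /weight; move: uN; case: ifP => // _ _; exact: leq_b1.
lia.
Qed.

(** The forbidden letter becomes [o1] rather than [o0]: the second block holds only [o0], so it
    contributes no term to the relation. *)
Local Lemma kernel_step_left Y (f g : word) (t : 'I_n) : invariant_kernel Y ->
  (forall f' g', (total f' + total g' < total f + total g)%N -> Y f' g' = 0) ->
  (forall u : 'I_n, (N <= u)%N -> f u = o0) ->
  (forall u : 'I_n, (N <= u)%N -> g u = o0) ->
  (t < N)%N -> g t != o0 -> g t != o1 -> Y f g = 0.
Proof.
move=> iY IH fM gM tN gt0 gt1.
have gE := total_set_letter g t o1.
rewrite /weight tN gt0 gt1 eqxx andbF /= -/(total _) -/(total _) in gE.
apply: (kernel_step iY gt1) => u.
  move=> fu; have uN : (u < N)%N.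
    by rewrite ltnNge; apply: contra gt0 => /fM; rewrite fu => ->.
  apply: IH; have := total_set_letter f u o1.
  by rewrite /weight uN eqxx andbF /= -/(total _) -/(total _); lia.
rewrite ffunE; case: eqVneq => [->|ut gu]; rewrite ?tN //= eqb_id -leqNgt => /gM.
by rewrite gu => /eqP; rewrite eq_sym (negbTE o01).
Qed.

(* Lie moves first push the letters of the second block to [o0], then those of the
   first block to [{o0, o1}]; both decrease the weight. *)
Lemma invariant_kernel_eq0 Y : invariant_kernel Y ->
  (forall k, (k <= N)%N -> Y (step_word k) (step_word k) = 0) ->
  forall f g, Y f g = 0.
Proof.
move=> iY Y0 f g; move: {2}(total f + total g)%N (leqnn (total f + total g)) => m.
elim/ltn_ind: m f g => m IH f g fgm.
have {}IH f' g' : (total f' + total g' < total f + total g)%N -> Y f' g' = 0.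
  by move=> fg'; apply: (IH (total f' + total g')%N) => //; exact: leq_trans fg' fgm.
have IH' f' g' : (total f' + total g' < total g + total f)%N -> Y g' f' = 0.
  by move=> fg'; apply: IH; rewrite addnC (addnC (total f)).
have iY' := invariant_kernel_swap iY.
have [/existsP[t /andP[Nt gt]]|gM] := boolP [exists t : 'I_n, (N <= t)%N && (g t != o0)].
  exact: (kernel_step_right iY IH Nt gt).
have [/existsP[t /andP[Nt ft]]|fM] := boolP [exists t : 'I_n, (N <= t)%N && (f t != o0)].
  exact: (kernel_step_right iY' IH' Nt ft).
have blockM (h : word) : ~~ [exists t : 'I_n, (N <= t)%N && (h t != o0)] ->
    forall u : 'I_n, (N <= u)%N -> h u = o0.
  by rewrite negb_exists => /forallP hM u Nu; move/(_ u): hM; rewrite Nu negbK => /eqP.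
move/blockM: gM => gM; move/blockM: fM => fM.
have [/existsP[t /and3P[tN g0 g1]]|gN] :=
    boolP [exists t : 'I_n, [&& (t < N)%N, g t != o0 & g t != o1]].
  exact: (kernel_step_left iY IH fM gM tN g0 g1).
have [/existsP[t /and3P[tN f0 f1]]|fN] :=
    boolP [exists t : 'I_n, [&& (t < N)%N, f t != o0 & f t != o1]].
  exact: (kernel_step_left iY' IH' gM fM tN f0 f1).
have goodI (h : word) : ~~ [exists t : 'I_n, [&& (t < N)%N, h t != o0 & h t != o1]] ->
    (forall u : 'I_n, (N <= u)%N -> h u = o0) -> good h.
  rewrite negb_exists => /forallP hN hM; apply/forallP => t.
  case: ltnP => [tN|/hM->//]; move/(_ t): hN.
  by rewrite tN -negb_or negbK.
exact: (kernel_good0 iY Y0 (goodI _ fN fM) (goodI _ gN gM)).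
Qed.

Definition symmetric_invariant (X : op) : Prop :=
  [/\ tensor_comm X,
      forall s, young_subgroup s -> perm_op R d s *m X = X &
      forall s, young_subgroup s -> X *m perm_op R d s = X].

Lemma young_subgroupV s : young_subgroup s -> young_subgroup s^-1%g.
Proof.
move/forallP => ys; apply/forallP => t; have := ys (s^-1%g t).
by rewrite permKV eq_sym.
Qed.

Lemma symmetric_invariant_eq0 X : symmetric_invariant X ->
  (forall k, (k <= N)%N -> X (idx (step_word k)) (idx (step_word k)) = 0) -> X = 0.
Proof.
case=> cX Xl Xr X0.
have iY : invariant_kernel (fun f g => X (idx f) (idx g)).
  split=> [s f g ys|s f g ys|i j f g].
  - by rewrite -perm_mulE Xl.
  - by rewrite -[s]invgK -mul_permE Xr // young_subgroupV.
  - exact: lie_comm_entry.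
by apply/op_idxP => f g; rewrite mxE; exact: (invariant_kernel_eq0 iY).
Qed.

End Determination.

(** * Young symmetrizers and their blocks *)

Section OrthogonalProjection.
Variables (R : realType) (m : nat).
Local Notation C := (complex R).

Lemma adj_of_factor (P : 'M[C]_m) : P ^t* = P *m P ^t* -> P ^t* = P.
Proof. by move=> PE; have := adjM P (P ^t*); rewrite -PE !adjK -PE. Qed.

(** The adjoint of the second stability condition reads T P = P T P. *)
Lemma comm_of_invariant (P T : 'M[C]_m) : P ^t* = P ->
  P *m T = P *m T *m P -> P *m T ^t* = P *m T ^t* *m P -> P *m T = T *m P.
Proof.
move=> Pa PT PTa; have := adjM P (T ^t*).
by rewrite PTa !adjM !adjK Pa mulmxA -PT.
Qed.

(** The rows of 1 - P are orthogonal to W and those of P lie in W, so P^* = P P^*, which is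
    self-adjoint. *)
Lemma proj_ortho_adj p (W : 'M[C]_(p, m)) : (proj_ortho W) ^t* = proj_ortho W.
Proof.
pose P : 'M[C]_m := proj_ortho W; rewrite -/P.
have PP : (1%:M - P) *m P ^t* = 0.
  have := proj_ortho_compl_sub W (1%:M : 'M[C]_m); rewrite mul1mx -/P => /orthomx1P E.
  have := proj_ortho_sub W (1%:M : 'M[C]_m); rewrite mul1mx -/P => /submxP[D DE].
  by rewrite {2}DE trmx_mul map_mxM mulmxA E mul0mx.
have PE : P ^t* = P *m P ^t*.
  by apply/eqP; rewrite -subr_eq0 -{1}[P ^t*]mul1mx -mulmxBl PP.
exact: adj_of_factor.
Qed.

Lemma proj_ortho_comm p (W : 'M[C]_(p, m)) (T : 'M[C]_m) :
  (W *m T <= W)%MS -> (W *m T ^t* <= W)%MS -> proj_ortho W *m T = T *m proj_ortho W.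
Proof.
pose P : 'M[C]_m := proj_ortho W; rewrite -/P.
have Pa : P ^t* = P by exact: proj_ortho_adj.
have PT (S : 'M[C]_m) : (W *m S <= W)%MS -> P *m S = P *m S *m P.
  move=> WS; rewrite [RHS]proj_ortho_id //; apply: submx_trans WS.
  by rewrite submxMr // -[P]mul1mx proj_ortho_sub.
by move=> /PT WT /PT WTa; exact: comm_of_invariant.
Qed.

End OrthogonalProjection.

Lemma eq_opp_mx0 (R : realType) m p (X : 'M[complex R]_(m, p)) : X = - X -> X = 0.
Proof.
move=> XN; have /eqP : (2%:R : complex R) *: X = 0 by rewrite scaler_nat mulr2n {1}XN addNr.
by rewrite scaler_eq0 pnatr_eq0 => /eqP.
Qed.

Section GroupSums.
Variables (R : realType) (d n : nat).
Local Notation C := (complex R).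
Local Notation word := {ffun 'I_n -> 'I_d}.
Local Notation op := 'M[C]_(tensor_dim d n).

(** One notion covers the row stabilizer, the column stabilizer and S_N x S_M: F is the row, the
    column or the block of a position. *)
Definition stab (T : eqType) (F : 'I_n -> T) : pred 'S_n :=
  fun s => [forall t, F (s t) == F t].

Section Stab.
Variables (T : eqType) (F : 'I_n -> T).

Lemma stabP (s : 'S_n) : reflect (forall t, F (s t) = F t) (stab F s).
Proof. by apply: (iffP forallP) => Fs t; apply/eqP. Qed.

Lemma stab1 : stab F 1%g.
Proof. by apply/stabP => t; rewrite perm1. Qed.

Lemma stabM s u : stab F s -> stab F u -> stab F (s * u)%g.
Proof. by move=> /stabP Fs /stabP Fu; apply/stabP => t; rewrite permM Fu. Qed.

Lemma stabV s : stab F s^-1%g = stab F s.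
Proof.
have V u : stab F u -> stab F u^-1%g.
  by move=> /stabP Fu; apply/stabP => t; rewrite -{2}[t](permKV u) Fu.
by apply/idP/idP => [/V|/V //]; rewrite invgK.
Qed.

Lemma stabMl s u : stab F s -> stab F (s * u)%g = stab F u.
Proof.
move=> Fs; apply/idP/idP => [Fsu|]; last exact: stabM.
by rewrite -[u](mulKg s) stabM ?stabV.
Qed.

Lemma stab_tperm t u : F t = F u -> stab F (tperm t u).
Proof. by move=> tu; apply/stabP => v; case: tpermP => [->|->|]. Qed.

(* [e] selects between symmetrizers (trivial character) and antisymmetrizers. *)
Definition sgn (e : bool) (s : 'S_n) : C := (-1) ^+ (e && odd_perm s).

Definition gsum (e : bool) : op := \sum_(s | stab F s) sgn e s *: perm_op R d s.

Lemma sgnM e s u : sgn e (s * u)%g = sgn e s * sgn e u.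
Proof. by rewrite /sgn; case: e; rewrite ?mul1r //= odd_permM signr_addb. Qed.

Lemma sgnV e s : sgn e s^-1%g = sgn e s.
Proof. by rewrite /sgn odd_permV. Qed.

Lemma sgnK e s : sgn e s * sgn e s = 1.
Proof. by rewrite /sgn -signr_addb addbb. Qed.

Lemma gsum_permr e s : stab F s -> gsum e *m perm_op R d s = sgn e s *: gsum e.
Proof.
move=> Fs; rewrite /gsum mulmx_suml scaler_sumr [RHS](reindex_inj (mulgI s)) /=.
apply: eq_big => u; first by rewrite stabMl.
by rewrite -scalemxAl perm_opM sgnM scalerA mulrA sgnK mul1r.
Qed.

Lemma gsum_adj e : (gsum e) ^t* = gsum e.
Proof.
rewrite /gsum raddf_sum /= map_mx_sum (reindex_inj invg_inj) /=.
apply: eq_big => u; first by rewrite stabV.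
rewrite linearZ /= map_mxZ perm_op_adj invgK sgnV /sgn.
by rewrite rmorphXn /= rmorphN1.
Qed.

Lemma gsum_perml e s : stab F s -> perm_op R d s *m gsum e = sgn e s *: gsum e.
Proof.
move=> Fs; rewrite -[LHS]adjK adjM gsum_adj perm_op_adj gsum_permr ?stabV //.
by rewrite linearZ /= map_mxZ gsum_adj sgnV /sgn rmorphXn /= rmorphN1.
Qed.

Lemma gsum_idem e : gsum e *m gsum e = #|[pred s | stab F s]|%:R *: gsum e.
Proof.
rewrite {2}/gsum mulmx_sumr (eq_bigr (fun=> gsum e)) => [|s Fs]; last first.
  by rewrite -scalemxAr gsum_permr // scalerA sgnK scale1r.
by rewrite sumr_const scaler_nat.
Qed.

Lemma card_stab_neq0 : #|[pred s | stab F s]|%:R != 0 :> C.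
Proof. by rewrite pnatr_eq0 -lt0n; apply/card_gt0P; exists 1%g; rewrite inE stab1. Qed.

Lemma gsum_tensor e A : gsum e *m tensor_prod (fun _ : 'I_n => A) =
  tensor_prod (fun _ : 'I_n => A) *m gsum e.
Proof.
rewrite /gsum mulmx_suml mulmx_sumr; apply: eq_bigr => s _.
by rewrite -scalemxAl -scalemxAr perm_op_tensor.
Qed.

End Stab.

Arguments gsum {T} F e.

(** The antisymmetrizer absorbs the transposition (t u) with sign -1, while its conjugate by g is
    absorbed by the symmetrizer with sign +1; the product equals its own negative. *)
Lemma gsum_vanish (T1 T2 : eqType) (F : 'I_n -> T1) (G : 'I_n -> T2) (g : 'S_n) (t u : 'I_n) :
  t != u -> F (g t) = F (g u) -> G t = G u ->
  gsum F false *m perm_op R d g *m gsum G true = 0.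
Proof.
move=> tu Fg Gtu; set X := LHS.
apply: eq_opp_mx0.
have sG : sgn true (tperm t u) = -1 by rewrite /sgn /= odd_tperm tu.
have -> : - X = gsum F false *m perm_op R d g *m (perm_op R d (tperm t u) *m gsum G true).
  by rewrite gsum_perml ?stab_tperm // sG scaleN1r mulmxN.
rewrite mulmxA -(mulmxA (gsum _ _)) perm_opM.
have -> : (tperm t u * g = g * tperm (g t) (g u))%g by rewrite -tpermJ -conjgC.
rewrite -perm_opM mulmxA gsum_permr ?stab_tperm //.
by rewrite /sgn scale1r.
Qed.

Definition ket (f : word) : 'cV[C]_(tensor_dim d n) := delta_mx (idx f) 0.

Lemma perm_ket s f : perm_op R d s *m ket f = ket (fperm f s^-1%g).
Proof.
apply/mx_idxP => h j; rewrite perm_mulE !mxE !(inj_eq enum_rank_inj).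
congr ((nat_of_bool (_ && _))%:R); apply/eqP/eqP => [<-|->].
  by rewrite fpermK.
by rewrite fpermVK.
Qed.

Lemma ket_entry (A : op) f g : ((ket f) ^t* *m A *m ket g) 0 0 = A (idx f) (idx g).
Proof.
by rewrite trmx_delta map_delta_mx -rowE -colE !mxE.
Qed.

End GroupSums.

Arguments gsum {R d n T} F e.
Arguments ket {R d n} f.

Lemma adj_mul_eq0 (R : realType) m p (A : 'M[complex R]_(m, p)) : A ^t* *m A = 0 -> A = 0.
Proof.
move=> A0; apply/matrixP => i j; rewrite mxE; apply/eqP.
have /eqP : (A ^t* *m A) j j = 0 by rewrite A0 mxE.
rewrite mxE psumr_eq0 => [/allP/(_ i)|k _]; last by rewrite adjE mulrC mul_conjC_ge0.
by rewrite mem_index_enum adjE mulrC mul_conjC_eq0; exact.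
Qed.

(** [gsum F e] is a positive multiple of an orthogonal projector, so a vector where its quadratic
    form vanishes lies in its kernel. *)
Lemma gsum_null_form (R : realType) (d n m : nat) (T : eqType) (F : 'I_n -> T) e
    (X : 'M[complex R]_(tensor_dim d n, m)) :
  X ^t* *m (gsum F e *m X) = 0 -> gsum F e *m X = 0.
Proof.
move=> X0; apply: adj_mul_eq0; rewrite adjM gsum_adj -mulmxA (mulmxA (gsum F e)) gsum_idem.
by rewrite -scalemxAl -scalemxAr X0 scaler0.
Qed.

Lemma adj_sandwich (R : realType) m1 m2 m3 m4 (A : 'M[complex R]_(m2, m1))
    (B : 'M[complex R]_(m2, m3)) (D : 'M[complex R]_(m3, m4)) :
  (A ^t* *m B *m D) ^t* = D ^t* *m B ^t* *m A.
Proof. by rewrite !adjM adjK mulmxA. Qed.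

Section YoungProjection.
Variables (R : realType) (d n : nat) (la : seq nat).
Local Notation C := (complex R).
Local Notation word := {ffun 'I_n -> 'I_d}.
Local Notation op := 'M[C]_(tensor_dim d n).
Local Notation Pi := (young_proj R d n la : op).
Local Notation y := (young_symmetrizer R d n la : op).

Definition row_of (t : 'I_n) : nat := reshape_index la t.
Definition col_of (t : 'I_n) : nat := reshape_offset la t.

Lemma young_symmetrizerE : y = gsum row_of false *m gsum col_of true.
Proof.
by congr (_ *m _); rewrite /gsum; apply: eq_bigr => s _; rewrite /sgn ?scale1r.
Qed.

Lemma young_symmetrizer_adj : y ^t* = gsum col_of true *m gsum row_of false.
Proof. by rewrite young_symmetrizerE adjM !gsum_adj. Qed.

Lemma young_proj_adj : Pi ^t* = Pi.
Proof. by rewrite /young_proj -map_trmx proj_ortho_adj. Qed.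

Lemma young_proj_idem : Pi *m Pi = Pi.
Proof. by rewrite /young_proj -trmx_mul proj_ortho_proj. Qed.

Lemma young_proj_id s : Pi *m (perm_op R d s *m y) = perm_op R d s *m y.
Proof.
apply: trmx_inj; rewrite trmx_mul trmxK proj_ortho_id //.
exact: (sumsmx_sup s).
Qed.

Lemma young_proj_kill m (Z : 'M[C]_(m, tensor_dim d n)) :
  (forall s, Z *m (perm_op R d s *m y) = 0) -> Z *m Pi = 0.
Proof.
move=> Z0; apply: trmx_inj; rewrite trmx_mul trmxK trmx0.
apply/sub_kermxP; rewrite proj_orthoE.
apply/sumsmx_subP => s _; apply/sub_kermxP.
by rewrite -trmx_mul Z0 trmx0.
Qed.

(** The hypotheses make the block stable under A and A^*; the right factor D is harmless because
    only column spaces matter. *)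
Lemma young_proj_comm (A : op) :
  (forall s, exists u D, A *m (perm_op R d s *m y) = perm_op R d u *m y *m D) ->
  (forall s, exists u D, A ^t* *m (perm_op R d s *m y) = perm_op R d u *m y *m D) ->
  Pi *m A = A *m Pi.
Proof.
have stable (B : op) :
    (forall s, exists u D, B *m (perm_op R d s *m y) = perm_op R d u *m y *m D) ->
    (young_block R d n la *m B^T <= young_block R d n la)%MS.
  move=> By; rewrite sumsmxMr; apply/sumsmx_subP => s _.
  rewrite -trmx_mul; have [u [D ->]] := By s.
  by rewrite trmx_mul mulmx_sub // (sumsmx_sup u).
move=> /stable sA /stable sAa; apply: trmx_inj; rewrite !trmx_mul trmxK.
apply/esym/proj_ortho_comm => //.
by move: sAa; rewrite map_trmx.
Qed.

Lemma young_proj_perm s : Pi *m perm_op R d s = perm_op R d s *m Pi.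
Proof.
by apply: young_proj_comm => u; rewrite ?perm_op_adj mulmxA perm_opM; eexists;
  exists 1%:M; rewrite mulmx1.
Qed.

Lemma young_proj_tensor (A : 'M[C]_d) :
  Pi *m tensor_prod (fun _ : 'I_n => A) = tensor_prod (fun _ : 'I_n => A) *m Pi.
Proof.
have comm (B : 'M[C]_d) s : tensor_prod (fun _ : 'I_n => B) *m (perm_op R d s *m y) =
    perm_op R d s *m y *m tensor_prod (fun _ : 'I_n => B).
  rewrite young_symmetrizerE mulmxA -perm_op_tensor -!mulmxA; congr (_ *m _).
  by rewrite gsum_tensor [RHS]mulmxA gsum_tensor !mulmxA.
by apply: young_proj_comm => s; exists s; rewrite ?tensor_prod_adj; eexists; exact: comm.
Qed.

End YoungProjection.

(** * Orthogonality of distinct two-row blocks *)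

Section TwoRows.
Variables (R : realType) (d n : nat).
Local Notation C := (complex R).
Local Notation word := {ffun 'I_n -> 'I_d}.
Local Notation op := 'M[C]_(tensor_dim d n).

Lemma row_of2 m k (t : 'I_n) : (m + k)%N = n -> row_of [:: m; k] t = (m <= t)%N.
Proof.
move=> mkn; rewrite /row_of /reshape_index /=.
have := ltn_ord t; rewrite -{2}mkn => tmk.
case: leqP => mt; first by rewrite subn_eq0 ltnNge mt /= subn_eq0 leq_subLR tmk.
by rewrite subn_eq0 mt.
Qed.

Lemma col_of2 m k (t : 'I_n) : (m + k)%N = n ->
  col_of [:: m; k] t = (if (m <= t)%N then t - m else t)%N.
Proof.
move=> mkn; rewrite /col_of /reshape_offset -/(row_of _ _) (row_of2 t mkn).
by case: leqP => _ /=; rewrite ?addn0 ?subn0.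
Qed.

(* Of k2 > k1 columns of length two, one avoids the second row of the other diagram. *)
Lemma row_col_collision m1 k1 m2 k2 (g : 'S_n) :
  (m1 + k1)%N = n -> (m2 + k2)%N = n -> (k1 < k2)%N -> (k2 <= m2)%N ->
  exists t u : 'I_n, [/\ t != u, row_of [:: m1; k1] (g t) = row_of [:: m1; k1] (g u) &
    col_of [:: m2; k2] t = col_of [:: m2; k2] u].
Proof.
move=> mk1 mk2 k12 km2.
have top_lt (c : 'I_k2) : (c < n)%N by have := ltn_ord c; lia.
have bot_lt (c : 'I_k2) : (m2 + c < n)%N by have := ltn_ord c; lia.
pose top c := Ordinal (top_lt c); pose bot c := Ordinal (bot_lt c).
have [/existsP[c /andP[ct cb]]|nex] :=
    boolP [exists c, (g (top c) < m1)%N && (g (bot c) < m1)%N].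
  exists (top c), (bot c); split.
  - by rewrite -val_eqE /=; have := ltn_ord c; lia.
  - by rewrite !row_of2 // leqNgt ct leqNgt cb.
  - rewrite !col_of2 //= leq_addr addKn.
    by case: leqP => //; have := ltn_ord c; lia.
have hP c : (m1 <= g (top c))%N || (m1 <= g (bot c))%N.
  by move: nex; rewrite negb_exists => /forallP/(_ c); rewrite negb_and -!leqNgt.
(* Pigeonhole: h selects in each two-cell column a cell that g sends to the second row of the other
   diagram, which has only k1 < k2 places. *)
pose h c := if (m1 <= g (top c))%N then g (top c) else g (bot c).
have h_inj : injective h.
  move=> c1 c2 hc; apply/val_inj.
  have tb (c c' : 'I_k2) : top c = bot c' -> False.
    by move=> /(congr1 val) /=; have := ltn_ord c; lia.
  move: hc; rewrite /h; case: ifP => _; case: ifP => _ /perm_inj E.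
  - exact: (congr1 val E).
  - by case: (tb _ _ E).
  - by case: (tb _ _ (esym E)).
  - by have := congr1 val E => /= /addnI.
have hm c : (m1 <= h c)%N by rewrite /h; have := hP c; case: ifP.
have shift_lt c : (h c - m1 < k1)%N by have := ltn_ord (h c); have := hm c; lia.
have /leq_card : injective (fun c => Ordinal (shift_lt c)).
  move=> c1 c2 /(congr1 val) /= E; apply/h_inj/val_inj => /=.
  by have := hm c1; have := hm c2; lia.
by rewrite !card_ord leqNgt k12.
Qed.

Lemma mul_gsum_eq0 (T : eqType) (F : 'I_n -> T) e (A B : op) g :
  (forall s, A *m perm_op R d s *m B = 0) ->
  A *m perm_op R d g *m (gsum F e *m B) = 0.
Proof.
move=> AB; rewrite /gsum mulmx_suml mulmx_sumr big1 // => s _.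
by rewrite -scalemxAl -scalemxAr mulmxA -(mulmxA A) perm_opM AB scaler0.
Qed.

(** The product is b1 a1 g a2 b2. Expanding a2 leaves terms a1 s b2, each killed by a collision when
    the second diagram has the longer second row; taking adjoints exchanges the two diagrams. *)
Lemma young_symmetrizer_orth m1 k1 m2 k2 g :
  (m1 + k1)%N = n -> (m2 + k2)%N = n -> k1 != k2 -> (k1 <= m1)%N -> (k2 <= m2)%N ->
  (young_symmetrizer R d n [:: m1; k1]) ^t* *m perm_op R d g *m
    young_symmetrizer R d n [:: m2; k2] = 0.
Proof.
wlog k12 : m1 k1 m2 k2 g / (k1 < k2)%N.
  move=> IH mk1 mk2 k12 km1 km2; case/orP: (leq_total k1 k2) => k12'.
    by apply: IH => //; rewrite ltn_neqAle k12.
  transitivity (((young_symmetrizer R d n [:: m2; k2]) ^t* *m perm_op R d g^-1%g *m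
    young_symmetrizer R d n [:: m1; k1]) ^t*).
    by rewrite adj_sandwich perm_op_adj invgK.
  rewrite IH ?trmx0 ?map_mx0 // 1?eq_sym //.
  by rewrite ltn_neqAle eq_sym k12.
move=> mk1 mk2 _ _ km2; rewrite young_symmetrizer_adj young_symmetrizerE.
have E : gsum (row_of [:: m1; k1]) false *m perm_op R d g *m
    (gsum (row_of [:: m2; k2]) false *m gsum (col_of [:: m2; k2]) true) = 0 :> op.
  apply: mul_gsum_eq0 => s.
  have [t [u [tu rtu ctu]]] := row_col_collision s mk1 mk2 k12 km2.
  exact: gsum_vanish tu rtu ctu.
by rewrite -!mulmxA in E *; rewrite E mulmx0.
Qed.

Lemma young_proj_orth m1 k1 m2 k2 :
  (m1 + k1)%N = n -> (m2 + k2)%N = n -> k1 != k2 -> (k1 <= m1)%N -> (k2 <= m2)%N ->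
  young_proj R d n [:: m1; k1] *m young_proj R d n [:: m2; k2] = 0.
Proof.
move=> mk1 mk2 k12 km1 km2; apply: young_proj_kill => s.
rewrite -[LHS]adjK adjM young_proj_adj young_proj_kill ?trmx0 ?map_mx0 // => u.
rewrite adjM perm_op_adj -!mulmxA (mulmxA (perm_op _ _ _) (perm_op _ _ _)) perm_opM mulmxA.
by rewrite young_symmetrizer_orth // eq_sym.
Qed.

End TwoRows.

(** * Each block meets Sym^N (x) Sym^M *)

Section NonVanishing.
Variables (R : realType) (d N M j : nat) (o0 o1 : 'I_d).
Hypotheses (o01 : o0 != o1) (NM : (N <= M)%N) (jN : (j <= N)%N).
Local Notation C := (complex R).
Local Notation n := (N + M)%N.
Local Notation word := {ffun 'I_n -> 'I_d}.
Local Notation op := 'M[C]_(tensor_dim d n).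
Local Notation la := [:: (M + j)%N; (N - j)%N].
Local Notation a := (gsum (row_of la) false : op).
Local Notation b := (gsum (col_of la) true : op).

(* Antisymmetrizing the columns of its ket yields a highest weight vector. *)
Local Definition hw : word := [ffun t : 'I_n => if (t < M + j)%N then o0 else o1].

Local Lemma la_size : (M + j + (N - j))%N = n. Proof. by lia. Qed.

Local Lemma hw_row s : stab (row_of la) s -> fperm hw s = hw.
Proof.
move/stabP => rs; apply/ffunP => t; rewrite !ffunE !ltnNge.
by have := rs t; rewrite !(row_of2 _ la_size); do 2!case: (M + j <= _)%N.
Qed.

(** Fixing [hw] means preserving rows, and a cell is determined by its row and column. *)
Local Lemma hw_col s : stab (col_of la) s -> fperm hw s = hw -> s = 1%g.
Proof.
move=> /stabP cs hws; apply/permP => t; apply/val_inj; rewrite perm1 /=.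
move: (cs t); rewrite !(col_of2 _ la_size).
have := congr1 (fun f : word => f t) hws; rewrite !ffunE !ltnNge.
case: leqP => /= st; case: leqP => //= tt; [|move/esym|..]; try by move/eqP; rewrite (negbTE o01).
by move=> _; lia.
Qed.

Local Lemma antisym_ket0 (x : word) (t u : 'I_n) : t != u ->
  col_of la t = col_of la u -> x t = x u -> b *m ket x = 0.
Proof.
move=> tu ctu xtu; apply: eq_opp_mx0.
have {1}-> : ket x = perm_op R d (tperm t u) *m ket x.
  rewrite perm_ket tpermV; congr ket; apply/ffunP => v; rewrite ffunE.
  by case: tpermP => [->|->|].
by rewrite mulmxA gsum_permr ?stab_tperm // /sgn /= odd_tperm tu scaleN1r mulNmx.
Qed.

(** The permuted word x has [o0] on the first M positions, which contain the top of every two-cell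
    column because N <= M. An [o0] in the second row thus repeats within its column and is killed by
    antisymmetry. Otherwise the second row is all [o1], and counting [o1] gives x = [hw]. *)
Local Lemma antisym_perm_hw (p : 'S_n) : (forall t : 'I_n, (p t < M)%N = (t < M)%N) ->
  fperm hw p != hw -> b *m ket (fperm hw p) = 0.
Proof.
move=> pM; set x := fperm hw p => xhw.
have xE t : x t = if (p t < M + j)%N then o0 else o1 by rewrite /x !ffunE.
have x0 (t : 'I_n) : (t < M)%N -> x t = o0.
  by move=> tM; rewrite xE ifT // ltn_addr // pM.
have [/existsP[t /andP[tM /eqP xt]]|nex] :=
    boolP [exists t : 'I_n, (M + j <= t)%N && (x t == o0)].
  have ut : (t - (M + j) < n)%N by have := ltn_ord t; lia.
  have utM : (t - (M + j) < M)%N by have := ltn_ord t; lia.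
  apply: (@antisym_ket0 _ t (Ordinal ut)).
  - by rewrite -val_eqE /=; lia.
  - rewrite !(col_of2 _ la_size) tM /= ifF //; lia.
  - by rewrite xt x0.
case/eqP: xhw; pose S (f : word) := [set t | f t == o1].
have SE : S hw = S x.
  apply/eqP; rewrite eqEcard; apply/andP; split.
    apply/fintype.subsetP => t; rewrite !inE ffunE.
    case: ltnP => tM; first by rewrite (negbTE o01).
    move: nex; rewrite negb_exists => /forallP/(_ t); rewrite tM /= xE.
    by case: ifP; rewrite eqxx.
  have -> : S x = p @^-1: S hw by apply/setP => t; rewrite !inE ffunE.
  by rewrite card_preimset //; exact: perm_inj.
apply/ffunP => t; have := congr1 (fun A : {set 'I_n} => t \in A) SE; rewrite !inE xE ffunE.
by do 2!case: ifP; rewrite ?eqxx ?(negbTE o01).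
Qed.

Local Lemma antisym_hw_entry : b (idx hw) (idx hw) = 1.
Proof.
rewrite /gsum summxE (bigD1 1%g) ?stab1 //= big1 => [|s /andP[cs s1]].
  by rewrite /sgn odd_perm1 scale1r perm_op1 mxE eqxx addr0.
rewrite mxE perm_opE; case: eqP => [/(hw_col cs) s1'|]; last by rewrite mulr0.
by rewrite s1' eqxx in s1.
Qed.

Local Lemma sym_hw : a *m ket hw = #|[pred s : 'S_n | stab (row_of la) s]|%:R *: ket hw.
Proof.
rewrite /gsum mulmx_suml (eq_bigr (fun=> ket hw)) => [|s rs].
  by rewrite sumr_const scaler_nat.
by rewrite /sgn scale1r perm_ket hw_row // stabV.
Qed.

(** If b a b |hw> were zero, the form of a at b |hw> would vanish, hence a b |hw> too; but a |hw> is
    a positive multiple of |hw>, and <hw| b |hw> = 1. *)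
Local Lemma bab_hw_neq0 : b *m (a *m (b *m ket hw)) <> 0.
Proof.
move=> bab0; set r := #|[pred s : 'S_n | stab (row_of la) s]|%:R : C.
have r0 : r != 0 by exact: card_stab_neq0.
have ab0 : a *m (b *m ket hw) = 0.
  by apply: gsum_null_form; rewrite adjM gsum_adj -mulmxA bab0 mulmx0.
have : ((a *m ket hw) ^t* *m (b *m ket hw)) 0 0 = 0.
  by rewrite adjM gsum_adj -mulmxA ab0 mulmx0 mxE.
rewrite sym_hw linearZ /= map_mxZ -scalemxAl mxE mulmxA ket_entry antisym_hw_entry mulr1.
by move/eqP; rewrite conjC_eq0 (negbTE r0).
Qed.

Definition in_first (t : 'I_n) : bool := (t < N)%N.

(* If the symmetrizer S of S_N x S_M killed the block, then b a x S = 0 for every x in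
   the group algebra.  For x = b g, with g reversing the positions, g S g^-1 has the
   blocks [0, M) and [M, N + M), so that b g S maps the ket of [fperm hw g] to a positive
   multiple of b |hw>; but b a b |hw> is nonzero since <hw| a b |hw> is. *)
Lemma young_block_meets_symmetric :
  ~ (forall s, gsum in_first false *m (perm_op R d s *m young_symmetrizer R d n la) = 0).
Proof.
set S := gsum in_first false => S0.
have baS s : b *m a *m perm_op R d s *m S = 0.
  have := congr1 (fun X : op => X ^t*) (S0 s^-1%g).
  rewrite young_symmetrizerE !adjM perm_op_adj invgK !gsum_adj trmx0 map_mx0 => <-.
  by rewrite ?mulmxA.
pose g : 'S_n := perm (@rev_ord_inj n).
have gE t : val (g t) = (n - t.+1)%N by rewrite permE.
pose w := fperm hw g.
have bS : b *m perm_op R d g *m S *m ket w =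
    (\sum_(s | stab in_first s) (fperm (fperm w s^-1%g) g^-1%g == hw)%:R : C) *: (b *m ket hw).
  rewrite /S {2}/gsum mulmx_sumr mulmx_suml scaler_suml; apply: eq_bigr => s /stabP Hs.
  rewrite /sgn scale1r -!mulmxA !perm_ket; case: eqP => [->|/eqP]; first by rewrite scale1r.
  rewrite scale0r /w !fpermM; apply: antisym_perm_hw => t.
  rewrite !permM; set u := g^-1%g t.
  have tu : t = g u by rewrite permKV.
  have := Hs (s^-1%g u); rewrite permKV /in_first tu !gE => us.
  by have := ltn_ord u; have := ltn_ord (s^-1%g u); lia.
have bab0 : b *m a *m perm_op R d 1%g *m (b *m (perm_op R d g *m S)) = 0.
  by apply: mul_gsum_eq0 => s; rewrite -!mulmxA (mulmxA (perm_op _ _ s)) perm_opM !mulmxA.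
have := congr1 (fun X : op => X *m ket w) bab0.
rewrite mul0mx perm_op1 mulmx1 (mulmxA b) -(mulmxA (b *m a)) bS -scalemxAr -mulmxA => /eqP.
rewrite scaler_eq0 -natr_sum pnatr_eq0 => /orP[|/eqP]; last exact: bab_hw_neq0.
(* The identity contributes 1, so the coefficient of b |hw> is a positive integer. *)
rewrite (bigD1 1%g) ?stab1 //= invg1 fperm1 /w fpermK eqxx //.
Qed.

End NonVanishing.

Local Open Scope classical_set_scope.

(** * Real and imaginary parts *)

Lemma ReD (R : realType) (x y : complex R) : complex.Re (x + y) = complex.Re x + complex.Re y.
Proof. by case: x y => ? ? []. Qed.

Lemma ImD (R : realType) (x y : complex R) : complex.Im (x + y) = complex.Im x + complex.Im y.
Proof. by case: x y => ? ? []. Qed.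

Lemma ReM (R : realType) (x y : complex R) :
  complex.Re (x * y) = complex.Re x * complex.Re y - complex.Im x * complex.Im y.
Proof. by case: x y => ? ? []. Qed.

Lemma ImM (R : realType) (x y : complex R) :
  complex.Im (x * y) = complex.Re x * complex.Im y + complex.Im x * complex.Re y.
Proof. by case: x y => ? ? []. Qed.

Lemma ReJ (R : realType) (x : complex R) : complex.Re x^* = complex.Re x.
Proof. by case: x. Qed.

Lemma ImJ (R : realType) (x : complex R) : complex.Im x^* = - complex.Im x.
Proof. by case: x. Qed.

(** * Integrals of bounded complex functions *)

Section ComplexIntegral.
Context {disp : measure_display} {T : measurableType disp} {R : realType}.
Variable mu : probability T R.
Local Notation C := (complex R).

Definition bounded_measurable (f : T -> R) :=
  measurable_fun [set: T] f /\ exists B, forall x, `|f x| <= B.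

Lemma bounded_measurable_integrable f :
  bounded_measurable f -> mu.-integrable [set: T] (EFin \o f).
Proof.
move=> [mf [B fB]]; apply: measurable_bounded_integrable => //.
  exact: fin_num_fun_lty.
exists B; split; first exact: num_real.
by move=> r Br x _; exact: le_trans (fB x) (ltW Br).
Qed.

Lemma bounded_measurable_cst (r : R) : bounded_measurable (fun=> r).
Proof. by split; [exact: measurable_cst | exists `|r|]. Qed.

Lemma bounded_measurableD f g : bounded_measurable f -> bounded_measurable g ->
  bounded_measurable (fun x => f x + g x).
Proof.
move=> [mf [B fB]] [mg [D gD]]; split; first exact: measurable_funD.
by exists (B + D) => x; rewrite (le_trans (ler_normD _ _)) // lerD.
Qed.

Lemma bounded_measurableM f g : bounded_measurable f -> bounded_measurable g ->
  bounded_measurable (fun x => f x * g x).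
Proof.
move=> [mf [B fB]] [mg [D gD]]; split; first exact: measurable_funM.
by exists (B * D) => x; rewrite normrM ler_pM.
Qed.

Lemma bounded_measurableN f : bounded_measurable f -> bounded_measurable (fun x => - f x).
Proof.
move=> [mf [B fB]]; split; first exact: measurable_funN.
by exists B => x; rewrite normrN.
Qed.

Definition cbounded_measurable (F : T -> C) :=
  bounded_measurable (fun x => complex.Re (F x)) /\
  bounded_measurable (fun x => complex.Im (F x)).

Lemma cbounded_measurable_cst (c : C) : cbounded_measurable (fun=> c).
Proof. by split; exact: bounded_measurable_cst. Qed.

Lemma cbounded_measurableD F G : cbounded_measurable F -> cbounded_measurable G ->
  cbounded_measurable (fun x => F x + G x).
Proof.
move=> [Fr Fi] [Gr Gi]; split.
  by under eq_fun do rewrite ReD; exact: bounded_measurableD.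
by under eq_fun do rewrite ImD; exact: bounded_measurableD.
Qed.

Lemma cbounded_measurableM F G : cbounded_measurable F -> cbounded_measurable G ->
  cbounded_measurable (fun x => F x * G x).
Proof.
move=> [Fr Fi] [Gr Gi]; split.
  under eq_fun do rewrite ReM; apply: bounded_measurableD; first exact: bounded_measurableM.
  by apply: bounded_measurableN; exact: bounded_measurableM.
under eq_fun do rewrite ImM.
by apply: bounded_measurableD; exact: bounded_measurableM.
Qed.

Lemma cbounded_measurableJ F : cbounded_measurable F ->
  cbounded_measurable (fun x => (F x)^*).
Proof.
move=> [Fr Fi]; split; first by under eq_fun do rewrite ReJ.
by under eq_fun do rewrite ImJ; exact: bounded_measurableN.
Qed.

Lemma cbounded_measurable_sum (I : Type) (r : seq I) (F : I -> T -> C) :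
  (forall i, cbounded_measurable (F i)) ->
  cbounded_measurable (fun x => \sum_(i <- r) F i x).
Proof.
move=> mF; elim: r => [|i r IHr].
  by under eq_fun do rewrite big_nil; exact: cbounded_measurable_cst.
by under eq_fun do rewrite big_cons; exact: cbounded_measurableD.
Qed.

Lemma cbounded_measurable_prod (I : Type) (r : seq I) (F : I -> T -> C) :
  (forall i, cbounded_measurable (F i)) ->
  cbounded_measurable (fun x => \prod_(i <- r) F i x).
Proof.
move=> mF; elim: r => [|i r IHr].
  by under eq_fun do rewrite big_nil; exact: cbounded_measurable_cst.
by under eq_fun do rewrite big_cons; exact: cbounded_measurableM.
Qed.

Definition cintegral (F : T -> C) : C :=
  Complex (\int[mu]_(x in [set: T]) complex.Re (F x))
          (\int[mu]_(x in [set: T]) complex.Im (F x)).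

Lemma cintegralD F G : cbounded_measurable F -> cbounded_measurable G ->
  cintegral (fun x => F x + G x) = cintegral F + cintegral G.
Proof.
move=> [Fr Fi] [Gr Gi]; rewrite /cintegral.
under eq_Rintegral do rewrite ReD.
under [in X in Complex _ X]eq_Rintegral do rewrite ImD.
by rewrite !RintegralD //; exact: bounded_measurable_integrable.
Qed.

Lemma cintegralZ (c : C) F : cbounded_measurable F ->
  cintegral (fun x => c * F x) = c * cintegral F.
Proof.
move=> [Fr Fi]; rewrite /cintegral.
under eq_Rintegral do rewrite ReM.
under [in X in Complex _ X]eq_Rintegral do rewrite ImM.
have int r f : bounded_measurable f -> mu.-integrable [set: T] (EFin \o (fun x => r * f x)).
  move=> bf; apply: bounded_measurable_integrable.
  by apply: bounded_measurableM => //; exact: bounded_measurable_cst.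
rewrite RintegralB ?RintegralD //; do ?exact: int.
rewrite !RintegralZl //; do ?exact: bounded_measurable_integrable.
by case: c.
Qed.

Lemma cintegral_sum (I : Type) (r : seq I) (F : I -> T -> C) :
  (forall i, cbounded_measurable (F i)) ->
  cintegral (fun x => \sum_(i <- r) F i x) = \sum_(i <- r) cintegral (F i).
Proof.
move=> mF; elim: r => [|i r IHr].
  rewrite big_nil /cintegral; under eq_Rintegral do rewrite big_nil.
  under [in X in Complex _ X]eq_Rintegral do rewrite big_nil.
  by rewrite /Rintegral !integral0.
rewrite big_cons -IHr -cintegralD //; last exact: cbounded_measurable_sum.
by congr cintegral; apply/funext => x; rewrite big_cons.
Qed.

Lemma cintegral_ge0 F : (forall x, 0 <= F x) -> 0 <= cintegral F.
Proof.
move=> F0; have F0' x : complex.Im (F x) = 0 /\ 0 <= complex.Re (F x).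
  by have := F0 x; rewrite lecE /= => /andP[/eqP-> ->].
rewrite lecE /=; apply/andP; split.
  under eq_Rintegral do rewrite (F0' _).1.
  by rewrite /Rintegral integral0.
by apply: Rintegral_ge0 => x _; case: (F0' x).
Qed.

Lemma Rintegral_comp (phi : T -> T) f : measurable_fun [set: T] phi ->
  (forall A, measurable A -> mu (phi @^-1` A) = mu A) -> bounded_measurable f ->
  \int[mu]_(x in [set: T]) f (phi x) = \int[mu]_(x in [set: T]) f x.
Proof.
move=> mphi muphi bf; have [mf [B fB]] := bf; rewrite /Rintegral; congr fine.
rewrite [RHS](eq_measure_integral (pushforward mu phi)) => [|A mA _]; last exact/esym/muphi.
rewrite integral_pushforward ?preimage_setT //; first exact/measurable_EFinP.
apply: bounded_measurable_integrable; split; last by exists B.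
exact: measurableT_comp.
Qed.

Lemma cintegral_comp (phi : T -> T) F : measurable_fun [set: T] phi ->
  (forall A, measurable A -> mu (phi @^-1` A) = mu A) -> cbounded_measurable F ->
  cintegral (fun x => F (phi x)) = cintegral F.
Proof.
move=> mphi muphi [Fr Fi]; rewrite /cintegral.
by rewrite (Rintegral_comp mphi muphi Fr) (Rintegral_comp mphi muphi Fi).
Qed.

Definition cintegral_mx m p (F : T -> 'M[C]_(m, p)) : 'M[C]_(m, p) :=
  \matrix_(i, j) cintegral (fun x => F x i j).

Lemma eq_cintegral_mx m p (F G : T -> 'M[C]_(m, p)) :
  F =1 G -> cintegral_mx F = cintegral_mx G.
Proof. by move=> /funext ->. Qed.

Definition cbounded_measurable_mx m p (F : T -> 'M[C]_(m, p)) :=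
  forall i j, cbounded_measurable (fun x => F x i j).

Lemma cbounded_measurable_mulmx m p q (A : T -> 'M[C]_(m, p)) (B : T -> 'M[C]_(p, q)) :
  cbounded_measurable_mx A -> cbounded_measurable_mx B ->
  cbounded_measurable_mx (fun x => A x *m B x).
Proof.
move=> mA mB i j; under eq_fun do rewrite mxE.
by apply: cbounded_measurable_sum => k; exact: cbounded_measurableM.
Qed.

Lemma cbounded_measurable_mx_cst m p (A : 'M[C]_(m, p)) : cbounded_measurable_mx (fun=> A).
Proof. by move=> i j; exact: cbounded_measurable_cst. Qed.

Lemma cbounded_measurable_adj m p (A : T -> 'M[C]_(m, p)) :
  cbounded_measurable_mx A -> cbounded_measurable_mx (fun x => (A x) ^t*).
Proof.
by move=> mA i j; under eq_fun do rewrite !mxE; exact: cbounded_measurableJ.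
Qed.

Lemma cintegral_mxMl m p q (A : 'M[C]_(m, p)) (F : T -> 'M[C]_(p, q)) :
  cbounded_measurable_mx F -> cintegral_mx (fun x => A *m F x) = A *m cintegral_mx F.
Proof.
move=> mF; apply/matrixP => i j; rewrite !mxE.
under eq_fun do rewrite mxE.
rewrite cintegral_sum => [|k].
  by apply: eq_bigr => k _; rewrite cintegralZ // mxE.
by apply: cbounded_measurableM => //; exact: cbounded_measurable_cst.
Qed.

Lemma cintegral_mxMr m p q (A : 'M[C]_(p, q)) (F : T -> 'M[C]_(m, p)) :
  cbounded_measurable_mx F -> cintegral_mx (fun x => F x *m A) = cintegral_mx F *m A.
Proof.
move=> mF; apply/matrixP => i j; rewrite !mxE.
under eq_fun do rewrite mxE.
rewrite cintegral_sum => [|k].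
  apply: eq_bigr => k _; rewrite mxE mulrC -cintegralZ //; congr cintegral.
  by apply/funext => x; rewrite mulrC.
by apply: cbounded_measurableM => //; exact: cbounded_measurable_cst.
Qed.

End ComplexIntegral.

(** * The Haar average *)

Lemma adj_perm_fixed (R : realType) (d n m : nat) (s : 'S_n)
    (X : 'M[complex R]_(tensor_dim d n, m)) :
  perm_op R d s^-1%g *m X = X -> X ^t* *m perm_op R d s = X ^t*.
Proof. by move=> sX; rewrite -{2}sX adjM perm_op_adj invgK. Qed.

Lemma rank1_form_ge0 (R : realType) m (v x : 'cV[complex R]_m) :
  0 <= (v ^t* *m (x *m x ^t*) *m v) 0 0.
Proof.
have -> : v ^t* *m (x *m x ^t*) *m v = (v ^t* *m x) *m (v ^t* *m x) ^t*.
  by rewrite adjM adjK !mulmxA.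
by rewrite mxE big_ord1 adjE mul_conjC_ge0.
Qed.

Section HaarAverage.
Variables (R : realType) (d N M : nat).
Local Notation C := (complex R).
Local Notation n := (N + M)%N.
Local Notation word := {ffun 'I_n -> 'I_d}.
Local Notation op := 'M[C]_(tensor_dim d n).

Lemma unitary_entry_norm (U : 'M[C]_d) i j : U \is unitarymx -> `|U i j| <= 1.
Proof.
move=> /unitarymxP/matrixP/(_ i i); rewrite !mxE eqxx mulr1n => E.
rewrite -(@expr_le1 _ 2) // -E (bigD1 j) //= !mxE -normCK lerDl.
by rewrite sumr_ge0 // => k _; rewrite !mxE mul_conjC_ge0.
Qed.

Lemma complex_norm_le1 (z : C) : `|z| <= 1 ->
  `|complex.Re z| <= 1 /\ `|complex.Im z| <= 1.
Proof.
move=> z1; have : ((complex.Re z) ^+ 2 + (complex.Im z) ^+ 2)%:C%C <= 1%:C%C.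
  by rewrite add_Re2_Im2 expr_le1.
rewrite lecR => z2; split; rewrite -(@expr_le1 _ 2) // real_normK ?num_real //.
  by apply: le_trans z2; rewrite lerDl sqr_ge0.
by apply: le_trans z2; rewrite lerDr sqr_ge0.
Qed.

Lemma SU_unitary (U : SU R d) : sval U \is unitarymx.
Proof. by case: U => U /= /andP[]. Qed.

Lemma SU_entry_measurable i j :
  cbounded_measurable (fun U : SU_borel R d => sval U i j).
Proof.
split; split.
- move=> _ B mB; rewrite setTI; apply: sub_sigma_algebra.
  by exists i, j, B => //; left.
- by exists 1 => U; case: (complex_norm_le1 (unitary_entry_norm i j (SU_unitary U))).
- move=> _ B mB; rewrite setTI; apply: sub_sigma_algebra.
  by exists i, j, B => //; right.
- by exists 1 => U; case: (complex_norm_le1 (unitary_entry_norm i j (SU_unitary U))).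
Qed.

(** It suffices to test the generating coordinate sets, and the entries of V U are linear in those
    of U. *)
Lemma SU_mul_measurable (V : SU R d) :
  measurable_fun [set: SU_borel R d] (SU_mul V : SU_borel R d -> SU_borel R d).
Proof.
have mV i j : cbounded_measurable (fun U : SU_borel R d => sval (SU_mul V U) i j).
  have mVU : cbounded_measurable_mx (fun U : SU_borel R d => sval V *m sval U).
    by apply: cbounded_measurable_mulmx; [exact: cbounded_measurable_mx_cst|
      exact: SU_entry_measurable].
  exact: mVU.
apply: (@measurability _ _ (SU_borel R d) (SU_borel R d) setT (SU_mul V)
  (@SU_coordinate_sets R d)) => // _ [A + <-].
move=> [i [j [B mB]]] []->.
  by have [[mre _] _] := mV i j; exact: mre.
by have [_ [mim _]] := mV i j; exact: mim.
Qed.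

Variables psi phi : 'cV[C]_d.

Definition letter (t : 'I_n) : 'cV[C]_d := if (t < N)%N then psi else phi.

(** The product state is pure, so its invariances on both sides reduce to the invariance of one
    vector. *)
Definition product_vector : 'cV[C]_(tensor_dim d n) :=
  \col_f \prod_t letter t (multi_index f t) 0.

Lemma product_stateE : product_state N M psi phi = product_vector *m product_vector ^t*.
Proof.
apply/op_idxP => f g; rewrite tensor_prodE mxE big_ord1 !mxE rmorph_prod -big_split.
apply: eq_bigr => t _; rewrite !idxK /letter.
by case: splitP => k _; rewrite mxE big_ord1 !mxE.
Qed.

Lemma perm_product_vector s : young_subgroup s ->
  perm_op R d s *m product_vector = product_vector.
Proof.
move=> /forallP ys; apply/mx_idxP => f k; rewrite perm_mulE !mxE.
rewrite [RHS](reindex_inj (@perm_inj _ s)) /=; apply: eq_bigr => t _.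
by rewrite !idxK ffunE /letter (eqP (ys t)).
Qed.

Definition rotated_vector (U : SU_borel R d) : 'cV[C]_(tensor_dim d n) :=
  tensor_prod (fun _ : 'I_n => sval U) *m product_vector.

Lemma rotated_stateE U :
  rotated_state N M psi phi U = rotated_vector U *m (rotated_vector U) ^t*.
Proof. by rewrite /rotated_state product_stateE /rotated_vector adjM !mulmxA. Qed.

Lemma perm_rotated_vector s U : young_subgroup s ->
  perm_op R d s *m rotated_vector U = rotated_vector U.
Proof.
by move=> ys; rewrite /rotated_vector mulmxA perm_op_tensor -mulmxA perm_product_vector.
Qed.

Lemma rotated_state_measurable : cbounded_measurable_mx (@rotated_state R d N M psi phi).
Proof.
have mU : cbounded_measurable_mx
    (fun U : SU_borel R d => tensor_prod (fun _ : 'I_n => sval U)).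
  move=> f g; under eq_fun do rewrite mxE.
  by apply: cbounded_measurable_prod => t; exact: SU_entry_measurable.
apply: cbounded_measurable_mulmx; last exact: cbounded_measurable_adj.
by apply: cbounded_measurable_mulmx => //; exact: cbounded_measurable_mx_cst.
Qed.

Lemma rotated_stateM V U : rotated_state N M psi phi (SU_mul V U) =
  tensor_prod (fun _ : 'I_n => sval V) *m rotated_state N M psi phi U *m
    (tensor_prod (fun _ : 'I_n => sval V)) ^t*.
Proof. by rewrite /rotated_state /= -tensor_prodM adjM !mulmxA. Qed.

Variable mu : probability (SU_borel R d) R.
Hypothesis hmu : is_haar mu.
Local Notation rho := (average_state N M mu psi phi : op).

Lemma average_stateE : rho = cintegral_mx mu (@rotated_state R d N M psi phi).
Proof. by apply/matrixP => f g; rewrite !mxE. Qed.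

Lemma average_state_conj (V : SU R d) :
  tensor_prod (fun _ : 'I_n => sval V) *m rho *m
    (tensor_prod (fun _ : 'I_n => sval V)) ^t* = rho.
Proof.
have mrot := rotated_state_measurable.
rewrite average_stateE -(cintegral_mxMl _ _ mrot) -cintegral_mxMr; last first.
  by apply: cbounded_measurable_mulmx => //; exact: cbounded_measurable_mx_cst.
apply/matrixP => f g; rewrite [LHS]mxE [RHS]mxE.
rewrite -[RHS](cintegral_comp (SU_mul_measurable V) (@hmu V) (mrot f g)).
by congr cintegral; apply/funext => U; rewrite rotated_stateM.
Qed.

Lemma tensor_scale (c : C) (U : 'M[C]_d) :
  tensor_prod (fun _ : 'I_n => c *: U) = c ^+ n *: tensor_prod (fun _ : 'I_n => U).
Proof.
apply/op_idxP => f g; rewrite [RHS]mxE !tensor_prodE.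
under eq_bigr do rewrite mxE.
by rewrite big_split /= prodr_const card_ord.
Qed.

(** Take c to be a d-th root of 1 / det U, which has modulus 1. This carries commutation from SU(d)
    to all unitaries. *)
Lemma unitary_phase (U : 'M[C]_d) : (0 < d)%N -> U \is unitarymx ->
  exists2 c : C, c != 0 & special_unitary (c *: U).
Proof.
move=> d_gt0 uU; have detU : \det U * (\det U)^* = 1.
  move/unitarymxP: (uU) => /(congr1 determinant).
  by rewrite det_mulmx det_map_mx det_tr det1.
have nU : `|\det U| = 1.
  by apply/eqP; rewrite -(@pexpr_eq1 _ _ 2) // normCK detU.
pose c : C := d.-root (\det U)^-1.
have cd : c ^+ d = (\det U)^-1 by rewrite rootCK.
have nc : `|c| = 1.
  by apply/eqP; rewrite -(@pexpr_eq1 _ _ d) // -normrX cd normfV nU invr1.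
exists c; first by rewrite -normr_eq0 nc oner_eq0.
apply/andP; split; last first.
  by rewrite detZ cd mulVf // -normr_eq0 nU oner_eq0.
apply/unitarymxP; rewrite linearZ /= map_mxZ -scalemxAl -scalemxAr scalerA.
by rewrite (unitarymxP uU) -normCK nc expr1n scale1r.
Qed.

Lemma average_state_comm : (0 < d)%N -> tensor_comm rho.
Proof.
move=> d_gt0 U uU; have [c c0 sU] := unitary_phase d_gt0 uU.
pose V : SU R d := exist (@special_unitary R d) _ sU; set Vn := tensor_prod (fun _ : 'I_n => c *: U).
have VV : Vn ^t* *m Vn = 1%:M.
  rewrite tensor_prod_adj tensor_prodM -(@tensor_prod1 R d n); apply: eq_tensor_prod => t.
  have /unitarymxP := SU_unitary V; rewrite /= => /mulmx1C; exact.
have : Vn *m rho = rho *m Vn by rewrite -{2}(average_state_conj V) -!mulmxA VV mulmx1.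
rewrite /Vn tensor_scale -scalemxAl -scalemxAr => /(scalerI _); apply.
by rewrite expf_neq0.
Qed.

Lemma average_state_invariant : (0 < d)%N -> symmetric_invariant rho.
Proof.
move=> d_gt0; have mrot := rotated_state_measurable; split=> [|s ys|s ys].
- exact: average_state_comm.
- rewrite average_stateE -(cintegral_mxMl _ _ mrot); apply: eq_cintegral_mx => U.
  by rewrite rotated_stateE mulmxA perm_rotated_vector.
- rewrite average_stateE -(cintegral_mxMr _ _ mrot); apply: eq_cintegral_mx => U.
  rewrite rotated_stateE -mulmxA; congr (_ *m _).
  by apply: adj_perm_fixed; rewrite perm_rotated_vector ?young_subgroupV.
Qed.

Lemma average_state_psd (v : 'cV[C]_(tensor_dim d n)) : 0 <= (v ^t* *m rho *m v) 0 0.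
Proof.
have mrot := rotated_state_measurable.
rewrite average_stateE -(cintegral_mxMl _ _ mrot) -cintegral_mxMr; last first.
  by apply: cbounded_measurable_mulmx => //; exact: cbounded_measurable_mx_cst.
rewrite mxE; apply: cintegral_ge0 => U; rewrite rotated_stateE.
exact: rank1_form_ge0.
Qed.

End HaarAverage.

(** * Positivity of traces *)

Lemma gram_trace_ge0 (R : realType) m p (A : 'M[complex R]_(m, p)) : 0 <= \tr (A ^t* *m A).
Proof.
rewrite sumr_ge0 // => j _; rewrite mxE sumr_ge0 // => k _.
by rewrite adjE mulrC mul_conjC_ge0.
Qed.

Lemma gram_trace_eq0 (R : realType) m p (A : 'M[complex R]_(m, p)) :
  \tr (A ^t* *m A) = 0 -> A = 0.
Proof.
have ge0 j k : 0 <= (A ^t*) j k * A k j by rewrite adjE mulrC mul_conjC_ge0.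
move/eqP; rewrite psumr_eq0 => [/allP A0|j _]; last by rewrite mxE sumr_ge0.
apply/matrixP => k j; have := A0 j; rewrite mem_index_enum mxE => /(_ isT).
rewrite psumr_eq0 // => /allP/(_ k); rewrite mem_index_enum adjE mulrC mul_conjC_eq0.
by rewrite mxE => /(_ isT) /eqP.
Qed.

(** tr (E Q) = tr (Q^* E Q) is the sum of the form of E over the columns of Q. *)
Lemma form_trace_ge0 (R : realType) m (E Q : 'M[complex R]_m) :
  (forall v : 'cV_m, 0 <= (v ^t* *m E *m v) 0 0) -> Q ^t* = Q -> Q *m Q = Q ->
  0 <= \tr (E *m Q).
Proof.
move=> E0 Qa QQ; rewrite -QQ mulmxA mxtrace_mulC mulmxA -{1}Qa sumr_ge0 // => j _.
have := E0 (Q *m (delta_mx j 0 : 'cV_m)); congr (0 <= _).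
transitivity (((delta_mx 0 j : 'rV[complex R]_m) *m (Q ^t* *m E *m Q) *m (delta_mx j 0 : 'cV_m)) 0 0).
  by rewrite adjM trmx_delta map_delta_mx !mulmxA.
by rewrite -rowE -colE [LHS]mxE [LHS]mxE.
Qed.

Lemma psd_trace_ge0 (R : realType) m (E Q : 'M[complex R]_m) : psdmx E ->
  Q ^t* = Q -> Q *m Q = Q -> 0 <= \tr (E *m Q).
Proof. by case=> _; exact: form_trace_ge0. Qed.

(** * Decomposition of invariant operators *)

Section Decomposition.
Variables (R : realType) (d N M : nat).
Hypothesis NM : (N <= M)%N.
Local Notation C := (complex R).
Local Notation n := (N + M)%N.
Local Notation op := 'M[C]_(tensor_dim d n).
Local Notation Pi := (@PiJ R d N M).

Lemma symmetric_invariantD (X Y : op) :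
  symmetric_invariant X -> symmetric_invariant Y -> symmetric_invariant (X + Y).
Proof.
move=> [cX lX rX] [cY lY rY]; split=> [U uU|s ys|s ys].
- by rewrite mulmxDl mulmxDr cX // cY.
- by rewrite mulmxDr lX // lY.
- by rewrite mulmxDl rX // rY.
Qed.

Lemma symmetric_invariantZ a (X : op) :
  symmetric_invariant X -> symmetric_invariant (a *: X).
Proof.
move=> [cX lX rX]; split=> [U uU|s ys|s ys].
- by rewrite -scalemxAl -scalemxAr cX.
- by rewrite -scalemxAr lX.
- by rewrite -scalemxAl rX.
Qed.

Lemma symmetric_invariant_sum (I : Type) (r : seq I) (F : I -> op) :
  (forall i, symmetric_invariant (F i)) -> symmetric_invariant (\sum_(i <- r) F i).
Proof.
move=> iF; apply: big_ind => //; last exact: symmetric_invariantD.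
by split=> [U uU|s ys|s ys]; rewrite ?mulmx0 ?mul0mx.
Qed.

Definition sym_proj : op :=
  (#|[pred s : 'S_n | stab (@in_first N M) s]|%:R)^-1 *: gsum (@in_first N M) false.
Local Notation P := sym_proj.

Lemma sym_proj_adj : P ^t* = P.
Proof. by rewrite linearZ /= map_mxZ gsum_adj fmorphV rmorph_nat. Qed.

Lemma sym_proj_idem : P *m P = P.
Proof.
by rewrite -scalemxAl -scalemxAr gsum_idem scalerK ?card_stab_neq0.
Qed.

Lemma sym_proj_permr s : young_subgroup s -> P *m perm_op R d s = P.
Proof. by move=> ys; rewrite -scalemxAl gsum_permr // /sgn scale1r. Qed.

Lemma sym_proj_perml s : young_subgroup s -> perm_op R d s *m P = P.
Proof. by move=> ys; rewrite -scalemxAr gsum_perml // /sgn scale1r. Qed.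

Lemma young_proj_sym la : young_proj R d n la *m P = P *m young_proj R d n la.
Proof.
rewrite -scalemxAl -scalemxAr; congr (_ *: _); rewrite /gsum mulmx_sumr mulmx_suml.
by apply: eq_bigr => s _; rewrite -scalemxAr -scalemxAl young_proj_perm.
Qed.

(* The projector onto the irreducible SU(d)-component of Sym^N (x) Sym^M in block j. *)
Definition component (j : 'I_N.+1) : op := Pi j *m P.

Lemma component_adj j : (component j) ^t* = component j.
Proof. by rewrite /component adjM sym_proj_adj young_proj_adj young_proj_sym. Qed.

Lemma PiJ_mul j k : Pi j *m Pi k = if j == k then Pi j else 0.
Proof.
case: eqVneq => [->|jk]; first exact: young_proj_idem.
have jN : (j <= N)%N by rewrite -ltnS. have kN : (k <= N)%N by rewrite -ltnS.
apply: young_proj_orth; try lia.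
by apply: contra jk => /eqP E; rewrite -val_eqE /=; lia.
Qed.

Lemma PiJ_component j k : Pi j *m component k = if j == k then component j else 0.
Proof.
by rewrite /component mulmxA PiJ_mul; case: eqP => // _; rewrite mul0mx.
Qed.

Lemma component_idem j : component j *m component j = component j.
Proof.
have PQ : P *m component j = component j.
  by rewrite /component /PiJ mulmxA -young_proj_sym -mulmxA sym_proj_idem.
by rewrite {1}/component -mulmxA PQ PiJ_component eqxx.
Qed.

Lemma component_invariant j : symmetric_invariant (component j).
Proof.
split=> [U uU|s ys|s ys].
- rewrite /component mulmxA -young_proj_tensor -!mulmxA; congr (_ *m _).
  by rewrite -scalemxAl -scalemxAr gsum_tensor.
- by rewrite mulmxA -young_proj_perm -mulmxA sym_proj_perml.
- by rewrite -mulmxA sym_proj_permr.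
Qed.

Variables (o0 o1 : 'I_d).
Hypothesis o01 : o0 != o1.

Lemma component_neq0 j : component j != 0.
Proof.
have jN : (j <= N)%N by rewrite -ltnS.
apply/eqP => Q0; apply: (@young_block_meets_symmetric R d N M j o0 o1 o01 NM jN) => s.
have c0 : #|[pred s : 'S_n | stab (@in_first N M) s]|%:R != 0 :> C by exact: card_stab_neq0.
have -> : gsum (@in_first N M) false =
    (#|[pred s : 'S_n | stab (@in_first N M) s]|%:R : C) *: P.
  by rewrite /sym_proj scalerA mulfV ?scale1r.
rewrite -scalemxAl -young_proj_id mulmxA -young_proj_sym.
have -> : young_proj R d n [:: (M + j)%N; (N - j)%N] *m P = component j by [].
by rewrite Q0 mul0mx scaler0.
Qed.

(** Evaluation at the N+1 diagonal entries is injective on invariant operators, and the components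
    are independent, since [Pi k] isolates the k-th. The square matrix of their evaluations is
    therefore invertible, and solving with it yields the coefficients. *)
Lemma symmetric_invariant_decomp (X : op) : symmetric_invariant X ->
  exists x : 'I_N.+1 -> C, X = \sum_j x j *: component j.
Proof.
move=> iX; pose e (k : 'I_N.+1) := idx (step_word N M o0 o1 k).
pose ev (Y : op) : 'rV[C]_N.+1 := \row_k Y (e k) (e k).
have ev0 Y : symmetric_invariant Y -> ev Y = 0 -> Y = 0.
  move=> iY Y0; apply: (symmetric_invariant_eq0 o01 iY) => k; rewrite -ltnS => kN.
  by have /rowP/(_ (Ordinal kN)) := Y0; rewrite !mxE.
pose L : 'M[C]_N.+1 := \matrix_(j, k) (ev (component j)) 0 k.
have evL (u : 'rV[C]_N.+1) : ev (\sum_j u 0 j *: component j) = u *m L.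
  apply/rowP => k; rewrite !mxE summxE; apply: eq_bigr => j _.
  by rewrite !mxE.
have iQ (u : 'rV[C]_N.+1) : symmetric_invariant (\sum_j u 0 j *: component j).
  by apply: symmetric_invariant_sum => j; apply/symmetric_invariantZ/component_invariant.
have L_unit : L \in unitmx.
  rewrite -row_free_unit; apply: inj_row_free => u uL.
  have u0 : \sum_j u 0 j *: component j = 0 by apply: ev0 => //; rewrite evL.
  apply/rowP => k; have /eqP := congr1 (fun Y : op => Pi k *m Y) u0.
  rewrite mulmx0 mulmx_sumr (bigD1 k) //= big1 ?addr0 => [|j jk].
    by rewrite -scalemxAr PiJ_component eqxx scaler_eq0 (negbTE (component_neq0 k)) orbF mxE => /eqP.
  by rewrite -scalemxAr PiJ_component eq_sym (negbTE jk) scaler0.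
pose u := ev X *m invmx L; exists (fun j => u 0 j).
apply/eqP; rewrite -subr_eq0 -scaleN1r; apply/eqP/ev0.
  exact/symmetric_invariantD/symmetric_invariantZ/iQ.
apply/rowP => k; have /rowP/(_ k) := evL u.
by rewrite /u mulmxKV // !mxE => ->; rewrite mulN1r subrr.
Qed.

End Decomposition.

(** * Jensen's inequality, monotonicity of integrals, outcome statistics *)

(** Expanding the square around the mean m, the cross term vanishes and the variance is dropped. The
    weights stay unnormalized because they will be tr (E_k Q_j), with sum tr Q_j. *)
Lemma jensen_sq (R : realType) (K : finType) (q e : K -> R) (c : R) :
  (forall k, 0 <= q k) -> 0 < \sum_k q k ->
  (\sum_k q k) * ((\sum_k q k * e k) / (\sum_k q k) - c) ^+ 2 <=
  \sum_k q k * (e k - c) ^+ 2.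
Proof.
move=> q0; set T := \sum_k q k; move=> T0; set m := _ / T.
have mT : \sum_k q k * (e k - m) = 0.
  under eq_bigr do rewrite mulrBr.
  by rewrite sumrB -mulr_suml -/T mulrC /m divfK ?subrr // gt_eqF.
have -> : \sum_k q k * (e k - c) ^+ 2 =
    \sum_k q k * (e k - m) ^+ 2 + 2 * (m - c) * (\sum_k q k * (e k - m)) + T * (m - c) ^+ 2.
  rewrite /T mulr_sumr mulr_suml -!big_split /=.
  by apply: eq_bigr => k _; ring.
by rewrite mT mulr0 addr0 lerDr sumr_ge0 // => k _; rewrite mulr_ge0 ?sqr_ge0.
Qed.

(* Unlike [ge0_le_integral], without measurability: the integral of a nonnegative
   function is a supremum over the simple functions below it. *)
Lemma ge0_le_integral_nonmeasurable (disp : measure_display) (T : measurableType disp)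
    (R : realType) (mu : {measure set T -> \bar R}) (D : set T) (f g : T -> \bar R) :
  (forall x, D x -> (0 <= f x)%E) -> (forall x, D x -> (f x <= g x)%E) ->
  (\int[mu]_(x in D) f x <= \int[mu]_(x in D) g x)%E.
Proof.
move=> f0 fg; have g0 x : D x -> (0 <= g x)%E by move=> Dx; exact: le_trans (f0 x Dx) (fg x Dx).
rewrite !ge0_integralE //; apply: le_ereal_sup => _ [h hf <-].
exists h => //= x; apply: le_trans (hf x) _.
by rewrite /patch; case: ifP => // /set_mem; exact: fg.
Qed.

Lemma Re_sum (R : realType) (I : finType) (F : I -> complex R) :
  complex.Re (\sum_i F i) = \sum_i complex.Re (F i).
Proof. by elim/big_rec2: _ => // i x y _ <-; rewrite ReD. Qed.

Lemma Re_trace_sum (R : realType) m (I : finType) (F : I -> 'M[complex R]_m) :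
  complex.Re (\tr (\sum_i F i)) = \sum_i complex.Re (\tr (F i)).
Proof. by rewrite -Re_sum; congr complex.Re; exact: raddf_sum. Qed.

Lemma complex_ge0 (R : realType) (z : complex R) :
  0 <= z -> 0 <= complex.Re z /\ complex.Im z = 0.
Proof. by rewrite lecE => /andP[/eqP Im0 Re0]; split. Qed.

Section Statistics.
Variables (R : realType) (d N M : nat) (o0 o1 : 'I_d).
Hypotheses (o01 : o0 != o1) (NM : (N <= M)%N).
Local Notation C := (complex R).
Local Notation n := (N + M)%N.
Local Notation op := 'M[C]_(tensor_dim d n).
Local Notation Pi := (@PiJ R d N M).
Local Notation component := (@component R d N M).

Lemma component_trace_gt0 j : 0 < \tr (component j).
Proof.
have E : \tr (component j) = \tr ((component j) ^t* *m component j).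
  by rewrite component_adj (component_idem R d NM).
rewrite lt_neqAle {2}E gram_trace_ge0 andbT eq_sym E.
apply: contra (component_neq0 R NM o01 j) => /eqP /gram_trace_eq0 Q0.
by rewrite Q0.
Qed.

(** Multiplying the decomposition of X by [Pi j] isolates one coefficient: x_j tr Q_j = tr (Pi_j X).
    So positivity of X makes x_j nonnegative, and x_j is the probability of outcome j divided by tr
    Q_j. *)
Lemma invariant_state_statistics (X : op) : symmetric_invariant X ->
  (forall v : 'cV_(tensor_dim d n), 0 <= (v ^t* *m X *m v) 0 0) ->
  exists x : 'I_N.+1 -> R, [/\ forall j, 0 <= x j,
    forall j, outcome_prob (Pi j) X = x j * complex.Re (\tr (component j)) &
    forall A, outcome_prob A X = \sum_j x j * complex.Re (\tr (A *m component j))].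
Proof.
move=> iX X0; have [x XE] := symmetric_invariant_decomp NM o01 iX.
have PiX j : \tr (Pi j *m X) = x j * \tr (component j).
  rewrite XE mulmx_sumr (bigD1 j) //= big1 ?addr0 => [|k kj].
    by rewrite -scalemxAr (PiJ_component R d NM) eqxx mxtraceZ.
  by rewrite -scalemxAr (PiJ_component R d NM) eq_sym (negbTE kj) scaler0.
have x0 j : 0 <= x j.
  rewrite -(pmulr_lge0 _ (component_trace_gt0 j)) -PiX mxtrace_mulC.
  by apply: form_trace_ge0 => //; [exact: young_proj_adj|exact: young_proj_idem].
have ReZ j z : complex.Re (x j * z) = complex.Re (x j) * complex.Re z.
  by rewrite ReM (complex_ge0 (x0 j)).2 mul0r subr0.
exists (fun j => complex.Re (x j)); split=> [j|j|A].
- by case: (complex_ge0 (x0 j)).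
- by rewrite /outcome_prob PiX ReZ.
- rewrite /outcome_prob XE mulmx_sumr Re_trace_sum; apply: eq_bigr => j _.
  by rewrite -scalemxAr /= mxtraceZ ReZ.
Qed.

End Statistics.

Theorem mainTheorem5 (R : realType) (d N M : nat)
    (hd : (2 <= d)%N) (hN : (1 <= N)%N) (hNM : (N <= M)%N)
    (mu : probability (SU_borel R d) R) (hmu : is_haar mu)
    (rho : R -> 'M[R[i]]_(tensor_dim d (N + M)))
    (hrho : forall c : R, 0 <= c <= 1 -> is_average_state_at mu c (rho c))
    (K : finType) (E : K -> 'M[R[i]]_(tensor_dim d (N + M))) (hE : is_povm E)
    (est : K -> R) :
  exists chat : 'I_N.+1 -> R,
    (forall c : R, 0 <= c <= 1 ->
       mean_sq_error (@PiJ R d N M) chat (rho c) c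
         <= mean_sq_error E est (rho c) c) /\
    (\int[lebesgue_measure]_(c in `[0%R, 1%R])
        (overlap_density d c * mean_sq_error (@PiJ R d N M) chat (rho c) c)%:E
     <= \int[lebesgue_measure]_(c in `[0%R, 1%R])
        (overlap_density d c * mean_sq_error E est (rho c) c)%:E)%E.
Proof.
have d_gt0 : (0 < d)%N by exact: ltnW.
pose o0 := Ordinal d_gt0; pose o1 := Ordinal hd.
have o01 : o0 != o1 by [].
(* The unnormalized q(k|j); its normalization is tr Q_j. *)
pose w k j := complex.Re (\tr (E k *m @component R d N M j)).
have w_ge0 k j : 0 <= w k j.
  suff /complex_ge0[] : 0 <= \tr (E k *m @component R d N M j) by [].
  by apply: psd_trace_ge0; [exact: hE.1|exact: component_adj|exact: (component_idem R d hNM)].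
have w_sum j : \sum_k w k j = complex.Re (\tr (@component R d N M j)).
  by rewrite -Re_trace_sum -mulmx_suml hE.2 mul1mx.
have T_gt0 j : 0 < \sum_k w k j.
  have := component_trace_gt0 R o01 hNM j; rewrite w_sum ltcE => /andP[_]; exact.
exists (fun j => (\sum_k w k j * est k) / \sum_k w k j).
set chat := fun j => _.
have stats c : 0 <= c <= 1 -> exists x : 'I_N.+1 -> R, [/\ forall j, 0 <= x j,
    forall j, outcome_prob (@PiJ R d N M j) (rho c) = x j * \sum_k w k j &
    forall k, outcome_prob (E k) (rho c) = \sum_j x j * w k j].
  move=> /hrho[psi [phi [_ _ _ ->]]].
  have [x [x0 xPi xE]] := invariant_state_statistics o01 hNM
    (average_state_invariant N M psi phi hmu d_gt0) (@average_state_psd R d N M psi phi mu).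
  by exists x; split=> [//|j|k]; rewrite ?xPi ?w_sum ?xE.
have mse_le c : 0 <= c <= 1 -> mean_sq_error (@PiJ R d N M) chat (rho c) c
    <= mean_sq_error E est (rho c) c.
  move=> /stats[x [x0 xPi xE]].
  rewrite /mean_sq_error; under eq_bigr do rewrite xPi -mulrA.
  under [leRHS]eq_bigr do rewrite xE mulr_suml.
  (* With j outermost, each summand is x_j times an instance of Jensen's inequality with weights
     [w k j]. *)
  rewrite exchange_big /=; apply: ler_sum => j _.
  under [leRHS]eq_bigr do rewrite -mulrA.
  by rewrite -mulr_sumr ler_wpM2l // jensen_sq.
(* [rho] is specified only pointwise in c; the comparison needs just that both integrands are
   ordered and the smaller one nonnegative on [0, 1]. *)
split=> //; apply: ge0_le_integral_nonmeasurable => c /=; rewrite in_itv /= => c01.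
  rewrite lee_fin mulr_ge0 //.
    by rewrite mulr_ge0 // exprn_ge0 // subr_ge0; case/andP: c01.
  have [x [x0 xPi _]] := stats c c01.
  apply: sumr_ge0 => j _; rewrite xPi; apply: mulr_ge0; last exact: sqr_ge0.
  by apply: mulr_ge0 => //; exact: ltW.
rewrite lee_fin ler_wpM2l ?mse_le //.
by rewrite mulr_ge0 // exprn_ge0 // subr_ge0; case/andP: c01.
Qed.
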